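(* Let $\mathbf A$ be the pseudovariety of finite aperiodic monoids. Stable pairs are decidable for $\mathbf A$: there is an algorithm that, given a finite monoid $M$, a subset $Y\subseteq M$ and a submonoid $N\le M$, decides whether $(Y,N)$ is an $\mathbf A$-stable pair of $M$. Equivalently, $\mathbf A$-inevitability is decidable for labellings (over finite monoids) of finite graphs with a single vertex in which every edge is labelled by a singleton.
   Context: A relational morphism $\varphi:M\to N$ of monoids assigns to each $m\in M$ a non-empty subset $m\varphi\subseteq N$ such that $1\in 1\varphi$ and $(m\varphi)(m'\varphi)\subseteq (mm')\varphi$. For $n\in N$, $n\varphi^{-1}=\{m\in M: n\in m\varphi\}$, and for $S\subseteq N$, $S\varphi^{-1}=\bigcup_{n\in S}n\varphi^{-1}$. For $m$ in a monoid $M$, $\mathrm{Stab}(m)=\{m'\in M: mm'=m\}$. For a pseudovariety of monoids $\mathbf V$ and a finite monoid $M$, a pair $(Y,U)$ with $Y\subseteq M$ a subset and $U\le M$ a submonoid is a $\mathbf V$-stable pair if, for all relational morphisms $\varphi:M\to N$ with $N\in\mathbf V$, there exists $n\in N$ such that $Y\subseteq n\varphi^{-1}$ and $U\le \mathrm{Stab}(n)\varphi^{-1}$. A (finite directed) graph $\Gamma$ has vertex set $V(\Gamma)$, edge set $E(\Gamma)$ and initial and terminal vertex maps $\iota,\tau:E(\Gamma)\to V(\Gamma)$. A labelling of $\Gamma$ over a monoid $M$ is a function $\ell:V(\Gamma)\cup E(\Gamma)\to P(M)$ (the power set). A singleton labelling is one with values in $M$ (singletons). A singleton labelling $\ell$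 commutes if $(e\iota\ell)(e\ell)=e\tau\ell$ for each edge $e$. Given a relational morphism $\varphi:M\to N$, a labelling $\ell$ over $M$ is $\varphi$-related to a singleton labelling $\ell'$ over $N$ if $x\ell\subseteq (x\ell')\varphi^{-1}$ for all vertices and edges $x$. A labelling $\ell$ of $\Gamma$ over a finite monoid $M$ is $\mathbf V$-inevitable if for every relational morphism $\varphi:M\to N$ with $N\in\mathbf V$ there is a commuting singleton labelling $\ell'$ of $\Gamma$ over $N$ to which $\ell$ is $\varphi$-related. Finite monoids are given by their multiplication tables. *)

(* Defs.v *)
From HB Require Import structures.
From mathcomp Require Import all_boot.

Set Implicit Arguments.
Unset Strict Implicit.
Unset Printing Implicit Defensive.

#[short(type="finMonoidType")]
HB.structure Definition FinMonoid := {M of Monoid M & Finite M}.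

(* The general recursive functions: the closure of the initial functions under
   composition, primitive recursion and minimisation of regular functions
   (those for which the minimisation is total), which is the class of total
   Turing-computable functions.  The decision procedures below are required to
   be in this class because, with classical axioms, a mere function into bool
   exists for every predicate. *)
Inductive recursive : forall k : nat, (k.-tuple nat -> nat) -> Prop :=
| rec_zero : recursive (fun _ : 0.-tuple nat => 0)
| rec_succ : recursive (fun v : 1.-tuple nat => (thead v).+1)
| rec_proj k (i : 'I_k) : recursive (fun v : k.-tuple nat => tnth v i)
| rec_comp k m (f : m.-tuple nat -> nat) (g : 'I_m -> k.-tuple nat -> nat) :
    recursive f -> (forall i, recursive (g i)) ->
    recursive (fun v : k.-tuple nat => f [tuple g i v | i < m])
| rec_prec k (f : k.-tuple nat -> nat) (g : k.+2.-tuple nat -> nat) :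
    recursive f -> recursive g ->
    recursive (fun v : k.+1.-tuple nat =>
      iteri (thead v) (fun n r => g [tuple of n :: r :: behead v])
        (f [tuple of behead v]))
| rec_mu k (f : k.+1.-tuple nat -> nat)
    (reg : forall v : k.-tuple nat, exists n, f [tuple of n :: v] == 0) :
    recursive f -> recursive (fun v : k.-tuple nat => ex_minn (reg v))
| rec_ext k (f g : k.-tuple nat -> nat) : f =1 g -> recursive f -> recursive g.

Definition recursive_pred (d : nat -> bool) : Prop :=
  recursive (fun v : 1.-tuple nat => nat_of_bool (d (thead v))).

Section RelationalMorphisms.
Local Open Scope group_scope.

Definition relational_morphism (M N : finMonoidType) (phi : M -> {set N}) : Prop :=
  [/\ forall m, phi m != set0,
      1 \in phi 1 &
      forall m m' n n', n \in phi m -> n' \in phi m' -> n * n' \in phi (m * m')].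

Definition relinv (M N : finMonoidType) (phi : M -> {set N}) (n : N) : {set M} :=
  [set m | n \in phi m].

Definition relpreim (M N : finMonoidType) (phi : M -> {set N}) (S : {set N}) :
    {set M} :=
  \bigcup_(n in S) relinv phi n.

Definition Stab (M : finMonoidType) (m : M) : {set M} :=
  [set m' | m * m' == m].

Definition stable_pair (V : finMonoidType -> Prop) (M : finMonoidType)
    (Y U : {set M}) : Prop :=
  monoid_closed (mem U) /\
  forall (N : finMonoidType) (phi : M -> {set N}),
    V N -> relational_morphism phi ->
    exists n : N, Y \subset relinv phi n /\ U \subset relpreim phi (Stab n).

Definition aperiodic (M : finMonoidType) : Prop :=
  forall x : M, exists n : nat, x ^+ n.+1 = x ^+ n.

End RelationalMorphisms.

Record digraph := Digraph {
  vertex : finType;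
  edge : finType;
  init : edge -> vertex;
  term : edge -> vertex }.

Definition labelling (G : digraph) (M : finMonoidType) : Type :=
  vertex G + edge G -> {set M}.

Definition singleton_labelling (G : digraph) (N : finMonoidType) : Type :=
  vertex G + edge G -> N.

Definition commutes (G : digraph) (N : finMonoidType)
    (l : singleton_labelling G N) : Prop :=
  forall e : edge G, (l (inl (init e)) * l (inr e))%g = l (inl (term e)).

Definition related (G : digraph) (M N : finMonoidType) (phi : M -> {set N})
    (l : labelling G M) (l' : singleton_labelling G N) : Prop :=
  forall x, l x \subset relinv phi (l' x).

Definition inevitable (V : finMonoidType -> Prop) (M : finMonoidType)
    (G : digraph) (l : labelling G M) : Prop :=
  forall (N : finMonoidType) (phi : M -> {set N}),
    V N -> relational_morphism phi ->
    exists l' : singleton_labelling G N, commutes l' /\ related phi l l'.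

(* Inputs of algorithms: the elements of a finite type are numbered in the order
   of its enumeration, and CodeSeq.code is a bijection from seq nat to nat. *)
Definition index_of (T : finType) (x : T) : nat := enum_rank x.

Definition code_set (T : finType) (A : {set T}) : nat :=
  CodeSeq.code [seq index_of x | x <- enum A].

Definition code_table (M : finMonoidType) : nat :=
  CodeSeq.code
    [seq CodeSeq.code [seq index_of (x * y)%g | y <- enum M] | x <- enum M].

Definition code_pair (M : finMonoidType) (Y U : {set M}) : nat :=
  CodeSeq.code [:: code_table M; code_set Y; code_set U].

Definition code_labelling (M : finMonoidType) (G : digraph)
    (l : labelling G M) : nat :=
  CodeSeq.code
    [:: code_table M;
        CodeSeq.code [seq code_set (l (inl v)) | v <- enum (vertex G)];
        CodeSeq.code
          [seq CodeSeq.code [:: index_of (init e); index_of (term e);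
                                code_set (l (inr e))]
          | e <- enum (edge G)]].

Definition stable_pairs_decidable (V : finMonoidType -> Prop) : Prop :=
  exists d : nat -> bool, recursive_pred d /\
    forall (M : finMonoidType) (Y U : {set M}), monoid_closed (mem U) ->
      d (code_pair Y U) <-> stable_pair V Y U.

Definition one_vertex_inevitability_decidable (V : finMonoidType -> Prop) : Prop :=
  exists d : nat -> bool, recursive_pred d /\
    forall (M : finMonoidType) (G : digraph) (l : labelling G M),
      #|vertex G| = 1 -> (forall e : edge G, #|l (inr e)| = 1) ->
      d (code_labelling l) <-> inevitable V l.

(* Main.v *)
From HB Require Import structures.
Require Import Defs.
From mathcomp Require Import all_boot boolp zify.
From mathcomp Require classical_sets filter.

Set Implicit Arguments.
Unset Strict Implicit.
Unset Printing Implicit Defensive.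

(* Proof idea.  A pair (Y, W) of subsets of M is stable if and only if it can be
   derived from the pairs ({m}, {}) by the rules of [derivable] below, and
   derivability is a closure computation in a finite set.

   Completeness rests on three facts.
   1. (Henckell) The first components of derivable pairs contain all the fibres
      of some relational morphism to an aperiodic monoid.  The proof is Wilke's
      induction: one splits words at the occurrences of a letter that shrinks the
      set of left multiples of the current value; if no letter does, they all act
      by permutations and all words can be identified.
   2. Iterating Schutzenberger products refines this morphism to congruences ~_k
      on words such that a factorization of a word lifts, up to ~_k, to every
      word which is ~_(k+1)-equivalent to it.
   3. In an ultraproduct of words modulo these congruences, let c be stabilized
      by s and t.  As c s = c = c t, one of s and t is the product of the other
      by an element z with c z = c.  Hence the values of the stabilizer of c form
      a finite submonoid H of P(M) with linearly ordered left ideals.  Going down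
      this chain, one derives a pair (f, W) where f is in H and W is the union of
      all elements of H. *)

Local Open Scope group_scope.

(** * Products of subsets *)

Section SetProduct.
Variable M : finMonoidType.
Implicit Types X Y Z : {set M}.

Definition setmul X Y : {set M} := [set p.1 * p.2 | p in setX X Y].

Lemma setmulP X Y m :
  reflect (exists x y, [/\ x \in X, y \in Y & m = x * y]) (m \in setmul X Y).
Proof.
apply: (iffP imsetP) => [[[x y]] /[!inE] /andP[/= Xx Yy] ->|[x [y [Xx Yy ->]]]].
  by exists x, y.
by exists (x, y); rewrite // inE Xx.
Qed.

Lemma setmulA : associative setmul.
Proof.
move=> X Y Z; apply/setP=> m; apply/setmulP/setmulP.
  move=> [x [_ [Xx /setmulP[y [z [Yy Zz ->]]] ->]]].
  by exists (x * y), z; rewrite mulgA; split=> //; apply/setmulP; exists x, y.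
move=> [_ [z [/setmulP[x [y [Xx Yy ->]]] Zz ->]]].
by exists x, (y * z); rewrite mulgA; split=> //; apply/setmulP; exists y, z.
Qed.

Lemma setmul1 : left_id [set 1] setmul.
Proof.
move=> X; apply/setP=> m; apply/setmulP/idP => [|Xm]; last first.
  by exists 1, m; rewrite set11 mul1g.
by move=> [x [y [/set1P-> Xy ->]]]; rewrite mul1g.
Qed.

Lemma setmulr1 : right_id [set 1] setmul.
Proof.
move=> X; apply/setP=> m; apply/setmulP/idP => [|Xm]; last first.
  by exists m, 1; rewrite set11 mulg1.
by move=> [x [y [Xx /set1P-> ->]]]; rewrite mulg1.
Qed.

End SetProduct.

HB.instance Definition _ (M : finMonoidType) :=
  isMonoid.Build {set M} (@setmulA M) (@setmul1 M) (@setmulr1 M).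

Local Notation word_prod f w := (\big[*%g/1]_(a <- w) f a).


Section SetProductTheory.
Variable M : finMonoidType.
Implicit Types (x y m : M) (X Y Z : {set M}).

Lemma mulSP X Y m :
  reflect (exists x y, [/\ x \in X, y \in Y & m = x * y]) (m \in X * Y).
Proof. exact: setmulP. Qed.

Lemma mem_mulS X Y x y : x \in X -> y \in Y -> x * y \in X * Y.
Proof. by move=> Xx Yy; apply/mulSP; exists x, y. Qed.

Lemma mulSS X X' Y Y' : X \subset X' -> Y \subset Y' -> X * Y \subset X' * Y'.
Proof.
move=> /subsetP sX /subsetP sY; apply/subsetP=> _ /mulSP[x [y [Xx Yy ->]]].
by rewrite mem_mulS ?sX ?sY.
Qed.

Lemma mem_oneS m : (m \in (1 : {set M})) = (m == 1).
Proof. exact: in_set1. Qed.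

Lemma mul_set1 x y : [set x] * [set y] = [set x * y] :> {set M}.
Proof.
apply/setP=> m; rewrite in_set1; apply/mulSP/eqP=>
  [[a [b [/set1P-> /set1P-> ->]]]//|->].
by exists x, y; rewrite !set11.
Qed.

Lemma mul_bigcupr (I : finType) X (F : I -> {set M}) :
  X * (\bigcup_i F i) = \bigcup_i (X * F i).
Proof.
apply/setP=> m; apply/mulSP/bigcupP.
  by move=> [x [y [Xx /bigcupP[i _ Fy] ->]]]; exists i => //; apply: mem_mulS.
move=> [i _ /mulSP[x [y [Xx Fy ->]]]].
by exists x, y; split=> //; apply/bigcupP; exists i.
Qed.

Lemma mul_bigcupl (I : finType) X (F : I -> {set M}) :
  (\bigcup_i F i) * X = \bigcup_i (F i * X).
Proof.
apply/setP=> m; apply/mulSP/bigcupP.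
  by move=> [x [y [/bigcupP[i _ Fy] Xy ->]]]; exists i => //; apply: mem_mulS.
move=> [i _ /mulSP[x [y [Fx Xy ->]]]].
by exists x, y; split=> //; apply/bigcupP; exists i.
Qed.

Lemma word_prod_set1 (A : Type) (f : A -> M) w :
  \big[*%g/1]_(a <- w) [set f a] = [set word_prod f w] :> {set M}.
Proof.
elim: w => [|a w IH]; first by rewrite !big_nil.
by rewrite !big_cons IH mul_set1.
Qed.

End SetProductTheory.

Lemma idempotent_power (N : finMonoidType) (x : N) :
  exists2 p, 0 < p & x ^+ p * x ^+ p = x ^+ p.
Proof.
have /injectivePn[/= i [j neq_ij eq_ij]] :
    ~~ injectiveb (fun i : 'I_#|N|.+1 => x ^+ i).
  apply/negP => /injectiveP /leq_card; rewrite card_ord ltnn //.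
wlog lt_ij : i j neq_ij eq_ij / i < j.
  move=> IH; case: (ltngtP i j) => [/IH|/IH|/val_inj eqij]; first exact.
    by apply=> //; rewrite eq_sym.
  by rewrite eqij eqxx in neq_ij.
set q := j - i; have q0 : 0 < q by rewrite subn_gt0.
have per k : x ^+ (i + k * q) = x ^+ i.
  elim: k => [|k IH]; first by rewrite addn0.
  rewrite mulSn addnA expgnDr.
  by rewrite (_ : i + q = j) -?eq_ij -?expgnDr ?IH // subnKC // ltnW.
(* A positive multiple of the period [q] that is at least the preperiod [i]. *)
exists (i.+1 * q)%N; first by rewrite muln_gt0.
have le : (i <= i.+1 * q)%N by rewrite (leq_trans (leqnSn i)) // leq_pmulr.
rewrite -expgnDr -{2 3}(subnKC le) addnC -addnA [_ - _ + _]addnC addnA.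
by rewrite expgnDr per -expgnDr.
Qed.

(** * Auxiliary monoids *)

Definition trivial_monoid : Type := unit.
HB.instance Definition _ := Finite.on trivial_monoid.
Definition trivial_mul (x y : trivial_monoid) : trivial_monoid := tt.
Lemma trivial_mulA : associative trivial_mul. Proof. by []. Qed.
Lemma trivial_mul1 : left_id tt trivial_mul. Proof. by case. Qed.
Lemma trivial_mulr1 : right_id tt trivial_mul. Proof. by case. Qed.
HB.instance Definition _ :=
  isMonoid.Build trivial_monoid trivial_mulA trivial_mul1 trivial_mulr1.

Lemma trivial_aperiodic : aperiodic trivial_monoid.
Proof. by move=> []; exists 0; case: (_ ^+ 1). Qed.

(** The carrier does not depend on [iota], but the product does; keeping [iota] as a parameter of
    the type lets the monoid instance find it. *)
Definition merge (N0 N1 : finMonoidType) (iota : N0 -> N1) : Type :=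
  (N0 + N0 * N1 * N0)%type.

Section Merge.
Variables (N0 N1 : finMonoidType) (iota : N0 -> N1).
Local Notation merge := (merge iota).

HB.instance Definition _ := Finite.on merge.

(* [inl x] is the value of a word without occurrence of the marked letter [a];
   [inr (x, p, y)] that of [u_0 a u_1 a ... a u_k], [k > 0], where [x] and [y]
   are the values of [u_0] and [u_k] and [p] is the value of the word
   [u_1 ... u_(k-1)] over the alphabet [N0]. *)
Definition merge_mul (s t : merge) : merge :=
  match s, t with
  | inl x, inl x' => inl (x * x')
  | inl x, inr (x', p', y') => inr (x * x', p', y')
  | inr (x, p, y), inl y' => inr (x, p, y * y')
  | inr (x, p, y), inr (x', p', y') => inr (x, p * iota (y * x') * p', y')
  end.

Lemma merge_mulA : associative merge_mul.
Proof.
by move=> [x|[[x p] y]] [x'|[[x' p'] y']] [x''|[[x'' p''] y'']] /=;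
  rewrite ?mulgA.
Qed.

Lemma merge_mul1 : left_id (inl 1) merge_mul.
Proof. by move=> [x|[[x p] y]] /=; rewrite mul1g. Qed.

Lemma merge_mulr1 : right_id (inl 1) merge_mul.
Proof. by move=> [x|[[x p] y]] /=; rewrite mulg1. Qed.

HB.instance Definition _ :=
  isMonoid.Build merge merge_mulA merge_mul1 merge_mulr1.

Lemma merge_mulE (s t : merge) : s * t = merge_mul s t. Proof. by []. Qed.

(** The powers of an element with marked letters change only in the middle component, which contains
    powers of [p * iota (y * x)] in [N1]. *)
Lemma merge_aperiodic : aperiodic N0 -> aperiodic N1 -> aperiodic merge.
Proof.
move=> ap0 ap1 [x|[[x p] y]].
  have expE k : (inl x : merge) ^+ k = inl (x ^+ k).
    by elim: k => // k IH; rewrite !expgS IH merge_mulE.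
  by have [n xn] := ap0 x; exists n; rewrite !expE xn.
have expE k :
    (inr (x, p, y) : merge) ^+ k.+1 = inr (x, (p * iota (y * x)) ^+ k * p, y).
  elim: k => [|k IH]; first by rewrite expg1 expg0 mul1g.
  by rewrite expgS IH merge_mulE /= [in RHS]expgS -!mulgA.
by have [n pn] := ap1 (p * iota (y * x)); exists n.+1; rewrite !expE pn.
Qed.

End Merge.

(** The triangular matrices of the Schutzenberger product of [N] with itself whose two diagonal
    entries agree; this common entry is stored once, next to the upper right entry. *)
Definition schutz (N : finMonoidType) : Type := (N * {set N * N})%type.

Section Schutzenberger.
Variable N : finMonoidType.
Local Notation schutz := (schutz N).
Implicit Type R : {set N * N}.

HB.instance Definition _ := Finite.on schutz.

Definition lact x R : {set N * N} := [set (x * q.1, q.2) | q in R].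
Definition ract R x : {set N * N} := [set (q.1, q.2 * x) | q in R].

(* The second component of the value of a word collects the values [(x, y)] of
   its factorizations [u v]. *)
Definition schutz_mul (s t : schutz) : schutz :=
  (s.1 * t.1, ract s.2 t.1 :|: lact s.1 t.2).

Lemma lact1 R : lact 1 R = R.
Proof.
by rewrite /lact -[RHS]imset_id; apply: eq_imset => -[a b]; rewrite mul1g.
Qed.

Lemma ract1 R : ract R 1 = R.
Proof.
by rewrite /ract -[RHS]imset_id; apply: eq_imset => -[a b]; rewrite mulg1.
Qed.

Lemma lactU x R R' : lact x (R :|: R') = lact x R :|: lact x R'.
Proof. exact: imsetU. Qed.

Lemma ractU x R R' : ract (R :|: R') x = ract R x :|: ract R' x.
Proof. exact: imsetU. Qed.

Lemma lactM x y R : lact x (lact y R) = lact (x * y) R.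
Proof. by rewrite /lact -imset_comp; apply: eq_imset => q /=; rewrite mulgA. Qed.

Lemma ractM x y R : ract (ract R x) y = ract R (x * y).
Proof. by rewrite /ract -imset_comp; apply: eq_imset => q /=; rewrite mulgA. Qed.

Lemma lract x y R : lact x (ract R y) = ract (lact x R) y.
Proof. by rewrite /lact /ract -!imset_comp. Qed.

Lemma schutz_mulA : associative schutz_mul.
Proof.
move=> [x R] [y S] [z T]; congr (_, _); rewrite /= ?mulgA //.
by rewrite ractU lactU setUA ractM lract lactM.
Qed.

Lemma schutz_mul1 : left_id (1, set0) schutz_mul.
Proof.
move=> [x R]; congr (_, _); rewrite /= ?mul1g // lact1.
by rewrite /ract imset0 set0U.
Qed.

Lemma schutz_mulr1 : right_id (1, set0) schutz_mul.
Proof.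
move=> [x R]; congr (_, _); rewrite /= ?mulg1 // ract1.
by rewrite /lact imset0 setU0.
Qed.

HB.instance Definition _ :=
  isMonoid.Build schutz schutz_mulA schutz_mul1 schutz_mulr1.

Lemma schutz_mulE (s t : schutz) : s * t = schutz_mul s t. Proof. by []. Qed.

(** Expanding the power of a triangular matrix: exactly one factor contributes its upper right
    entry, the [i] factors before it and the [j] after it their diagonal entry. *)
Lemma mem_schutz_exp (s : schutz) k a b :
  reflect (exists i j, (i + j).+1 = k /\
             exists2 q, q \in s.2 & (a, b) = (s.1 ^+ i * q.1, q.2 * s.1 ^+ j))
          ((a, b) \in (s ^+ k).2).
Proof.
have exp1 n : (s ^+ n).1 = s.1 ^+ n.
  by elim: n => // n IH; rewrite !expgS schutz_mulE /= IH.
elim: k a b => [|k IH] a b.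
  by rewrite expg0 in_set0; apply: ReflectF => -[i [j []]].
rewrite expgS schutz_mulE /= exp1 inE; apply: (iffP orP).
  move=> [/imsetP[q sq ->]|/imsetP[[a' b'] /IH[i [j [<- [q sq [-> ->]]]]] ->]] /=.
    by exists 0, k; split=> //; exists q; rewrite // expg0 mul1g.
  by exists i.+1, j; split=> //; exists q; rewrite // expgS mulgA.
move=> [[|i] [j [[ek] [q sq [-> ->]]]]].
  by left; apply/imsetP; exists q; rewrite // expg0 mul1g -ek.
right; apply/imsetP; exists (s.1 ^+ i * q.1, q.2 * s.1 ^+ j) => /=.
  by apply/IH; exists i, j; split=> //; exists q.
by rewrite mulgA -expgS.
Qed.

Lemma schutz_aperiodic : aperiodic N -> aperiodic schutz.
Proof.
move=> ap s; have [n xn] := ap s.1.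
have stab k : (n <= k)%N -> s.1 ^+ k.+1 = s.1 ^+ k.
  by move=> /subnK <-; rewrite -addnS !expgnDr xn.
have exp1 m : (s ^+ m).1 = s.1 ^+ m.
  by elim: m => // m IH; rewrite !expgS schutz_mulE /= IH.
exists (n + n).+1.
rewrite [LHS]surjective_pairing [RHS]surjective_pairing !exp1 stab; last first.
  exact: leq_trans (leq_addr _ _) (leqnSn _).
congr (_, _); apply/setP=> -[a b].
apply/mem_schutz_exp/mem_schutz_exp => -[i [j [[e] [q sq [-> ->]]]]].
  have [lt|le] := ltnP n i.
    case: i lt e => // i lt [e]; exists i, j; rewrite e; split=> //.
    by exists q => //; rewrite stab.
  have : (n < j)%N by rewrite -(ltn_add2l i) e ltnS leq_add2r.
  case: j e => // j e lt; move: e; rewrite addnS => -[e].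
  by exists i, j; rewrite e; split=> //; exists q => //; rewrite stab.
have [le|lt] := leqP n i.
  by exists i.+1, j; rewrite addSn e; split=> //; exists q => //; rewrite stab.
have le : (n <= j)%N by rewrite -(leq_add2l n) -e leq_add2r ltnW.
by exists i, j.+1; rewrite addnS e; split=> //; exists q => //; rewrite stab.
Qed.

(** A letter records its two trivial factorizations, and the product rule extends them. The empty
    word has the value [(1, set0)], which records none; hence the condition [w <> [::]]. *)
Lemma schutz_word (A : Type) (g : A -> N) (w : seq A) :
  let h a : schutz := (g a, [set (1, g a); (g a, 1)]) in
  (word_prod h w).1 = word_prod g w /\
  forall q, q \in (word_prod h w).2 <->
    w <> [::] /\ exists u v, w = u ++ v /\ q = (word_prod g u, word_prod g v).
Proof.
move=> h; elim: w => [|a w [IH1 IH2]].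
  by rewrite !big_nil; split=> // q; rewrite in_set0; split=> // -[].
rewrite !big_cons schutz_mulE /= IH1; split=> // q; rewrite inE.
split=> [/orP|].
  move=> [/imsetP[r]|/imsetP[r /IH2[_ [u [v [-> ->]]]] ->]].
    move=> /set2P[]-> ->; split=> //=.
      by exists [::], (a :: w); rewrite !big_nil big_cons.
    by exists [:: a], w; rewrite big_cons !big_nil mulg1 mul1g.
  by split=> //; exists (a :: u), v; rewrite big_cons.
move=> [_ [[|b u] [v [/= e ->]]]]; apply/orP.
  rewrite -e big_nil big_cons; left; apply/imsetP.
  by exists (1, g a); rewrite // set21.
case: e => <- e; rewrite big_cons; case: u e => [|c u] e.
  left; apply/imsetP; exists (g a, 1); first by rewrite set22.
  by rewrite e big_nil mulg1 mul1g.
right; apply/imsetP; exists (word_prod g (c :: u), word_prod g v) => //.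
by apply/IH2; split; [rewrite e | exists (c :: u), v].
Qed.

End Schutzenberger.

(** * Aperiodic pointlike sets *)

(** Letters stand for subsets of [M] through [b]: this is the union of the products of all words
    that [g] sends to [n]. *)
Definition fiber (M N : finMonoidType) (A : finType) (b : A -> {set M})
    (g : A -> N) (n : N) : {set M} :=
  [set m | `[< exists2 w, word_prod g w = n & m \in word_prod b w >]].

Lemma fiberP (M N : finMonoidType) (A : finType) (b : A -> {set M})
    (g : A -> N) (n : N) m :
  m \in fiber b g n <-> exists2 w, word_prod g w = n & m \in word_prod b w.
Proof. by rewrite inE; split=> /asboolP. Qed.

Section MergeFibers.
Variables (M N0 N1 : finMonoidType) (A : finType) (b : A -> {set M}) (a : A).
Let B := {c : A | c != a}.
Variables (g0 : B -> N0) (iota : N0 -> N1).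
Let Z0 := fiber (fun c : B => b (val c)) g0.
Let Z1 := fiber (fun n => Z0 n * b a) iota.

Definition merge_letter (c : A) : merge iota :=
  if insub c is Some c' then inl (g0 c') else inr (1, 1, 1).

Lemma merge_letter_val (c : B) : merge_letter (val c) = inl (g0 c).
Proof. by rewrite /merge_letter valK. Qed.

Lemma merge_letter_mark : merge_letter a = inr (1, 1, 1).
Proof. by rewrite /merge_letter insubF ?eqxx. Qed.

Definition merge_fiber (s : merge iota) : {set M} :=
  match s with
  | inl x => Z0 x
  | inr (x, p, y) => Z0 x * b a * Z1 p * Z0 y
  end.

Lemma one_fiber (C : finType) (N : finMonoidType) (f : C -> {set M}) (g : C ->
  N) :
  1 \in fiber f g 1.
Proof. by apply/fiberP; exists [::]; rewrite !big_nil // mem_oneS. Qed.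

Lemma cons_fiber (C : finType) (N : finMonoidType) (f : C -> {set M})
    (g : C -> N) c n :
  f c * fiber f g n \subset fiber f g (g c * n).
Proof.
apply/subsetP=> _ /mulSP[x [y [fx /fiberP[w <- fy] ->]]].
by apply/fiberP; exists (c :: w); rewrite big_cons // mem_mulS.
Qed.

Lemma word_merge_fiber w m :
  m \in word_prod b w -> m \in merge_fiber (word_prod merge_letter w).
Proof.
elim: w m => [|c w IH] m; rewrite !(big_nil, big_cons).
  by rewrite mem_oneS => /eqP->; apply: one_fiber.
move=> /mulSP[x [y [bx /IH + ->]]] {IH}; set s := \big[_/_]_(i <- w) _.
have [eca|neca] := eqVneq c a; last first.
  have [c' ec] : exists c' : B, c = val c' by exists (Sub c neca); rewrite SubK.
  rewrite {}ec {neca} in bx *; rewrite merge_letter_val merge_mulE.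
  case: s => [n|[[n p] z]] /= Hy.
    by apply: (subsetP (cons_fiber (fun c : B => b (val c)) g0 c' n));
      apply: mem_mulS.
  move: Hy; rewrite -!mulgA => /mulSP[u [v [Zu Zv ->]]]; rewrite [x * _]mulgA.
  apply: mem_mulS => //.
  by apply: (subsetP (cons_fiber (fun c : B => b (val c)) g0 c' n));
    apply: mem_mulS.
rewrite eca in bx *; rewrite merge_letter_mark merge_mulE.
case: s => [n|[[n p] z]] /= Hy.
  rewrite mul1g -[x]mul1g -[1 * x]mulg1.
  by do 3?[apply: mem_mulS] => //; apply: one_fiber.
rewrite !mul1g -[x]mul1g -[_ * y]mulgA.
rewrite -!mulgA; apply: mem_mulS; first exact: one_fiber.
apply: mem_mulS => //; move: Hy => /mulSP[u [v [Zu Zv ->]]].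
apply: mem_mulS => //.
exact: (subsetP (cons_fiber (fun n => Z0 n * b a) iota n p)).
Qed.

Lemma fiber_word0 n m : m \in Z0 n ->
  exists2 w, word_prod merge_letter w = inl n & m \in word_prod b w.
Proof.
move=> /fiberP[w <- mw]; exists (map val w); last by rewrite big_map.
rewrite big_map; elim: w {mw} => [|c w IH]; first by rewrite !big_nil.
by rewrite !big_cons merge_letter_val IH.
Qed.

(** A letter [n] of the outer alphabet is a block of value [n] followed by [a]. The block enters the
    middle component only if an [a] also stands before it, whence the mark in front. *)
Lemma fiber_word1 p m : m \in Z1 p ->
  exists2 w, (inr (1, 1, 1) : merge iota) * word_prod merge_letter w = inr (1,
    p, 1)
           & m \in word_prod b w.
Proof.
move=> /fiberP[w <-]; elim: w m => [|c w IH] m; rewrite !(big_nil, big_cons).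
  by rewrite mem_oneS => /eqP->; exists [::]; rewrite !big_nil ?mem_oneS ?mulg1.
move=> /mulSP[_ [y [/mulSP[u [v [/fiber_word0[w0 e0 w0u] av ->]]]
  /IH[w1 e1 w1y] ->]]].
exists (w0 ++ a :: w1); rewrite big_cat big_cons /=; last first.
  by rewrite -mulgA !mem_mulS.
by rewrite merge_letter_mark e0 !mulgA -mulgA e1 !merge_mulE /= !mul1g mulg1.
Qed.

(** Both sides follow the decomposition of words at the occurrences of [a]: a first block, the
    blocks closed by an [a], and a last block, chosen independently. *)
Lemma fiber_merge s : fiber b merge_letter s = merge_fiber s.
Proof.
apply/setP=> m; apply/idP/idP => [/fiberP[w <-]|]; first exact: word_merge_fiber.
move=> Hm; apply/fiberP; case: s Hm => [n /fiber_word0[w <-]|[[x p] y]] /=.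
  by exists w.
move=> /mulSP[_ [m4 [/mulSP[_ [m3 [/mulSP[m1 [m2 [H1 H2 ->]]]] H3 ->]]] H4 ->]].
have [w1 e1 w1m] := fiber_word0 H1.
have [w3 e3 w3m] := fiber_word1 H3.
have [w4 e4 w4m] := fiber_word0 H4.
exists (w1 ++ a :: w3 ++ w4).
  rewrite big_cat big_cons big_cat /= merge_letter_mark e1 e4 [X in _ * X]mulgA.
  by rewrite e3 !merge_mulE /= mulg1 mul1g.
by rewrite big_cat big_cons big_cat /= -!mulgA !mem_mulS.
Qed.

End MergeFibers.

(** * Covering by the fibres of an aperiodic monoid *)

Section Covering.
Variables (M : finMonoidType) (P : {set {set M}}).
Hypothesis P1 : 1 \in P.
Hypothesis PM : forall X Y, X \in P -> Y \in P -> X * Y \in P.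
Hypothesis Ppow : forall (X : {set M}) p, 0 < p -> X \in P ->
  X ^+ p * X ^+ p = X ^+ p ->
  \bigcup_(i < p.+1) X ^+ (p + i) \in P.

(** The left ideal generated by [x] under the action of [P]; [x] itself need not belong to [P]. *)
Definition lmul (x : {set M}) : {set {set M}} := [set s * x | s in P].

Lemma mem_lmul s x : s \in P -> s * x \in lmul x.
Proof. exact: imset_f. Qed.

Lemma lmul_trans x y z : x \in lmul y -> y \in lmul z -> x \in lmul z.
Proof.
move=> /imsetP[s Ps ->] /imsetP[t Pt ->]; rewrite mulgA.
by apply: mem_lmul; apply: PM.
Qed.

Lemma lmul_refl x : x \in lmul x.
Proof. by apply/imsetP; exists 1; rewrite ?mul1g. Qed.

Lemma lmul_mulr x y z : x \in lmul y -> x * z \in lmul (y * z).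
Proof. by move=> /imsetP[s Ps ->]; rewrite -mulgA mem_lmul. Qed.

(** An element [t] of maximal size among those of [lmul x] lying between [x] and [x * Z] turns out
    to be stable under every letter, so it contains all of [x * Z]. *)
Lemma permuting_covering (A : finType) (b : A -> {set M}) x :
  (forall a, lmul (x * b a) = lmul x) ->
  exists2 t, t \in lmul x & t = x * fiber b (fun=> tt : trivial_monoid) tt.
Proof.
move=> perm; set Z := fiber _ _ _.
have mem_b a : x * b a \in lmul x by rewrite -(perm a) lmul_refl.
have xZ : x \subset x * Z.
  by rewrite -{1}[x]mulg1 mulSS // sub1set one_fiber.
have Zb a : Z * b a \subset Z.
  apply/subsetP=> _ /mulSP[u [v [/fiberP[w _ wu] bv ->]]].
  apply/fiberP; exists (rcons w a); first by case: (word_prod _ _).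
  by rewrite -cats1 big_cat big_seq1; apply: mem_mulS.
pose good t := [&& t \in lmul x, x \subset t & t \subset x * Z].
have [|t /and3P[xt sxt stZ] tmax] := @arg_maxnP _ x good (fun t => #|t|).
  by rewrite /good lmul_refl subxx xZ.
exists t => //; apply/eqP; rewrite eqEsubset stZ /=.
have testbit a : t * b a \subset t.
  have /imsetP[s Ps xs] := mem_b a.
  have xk k : x * b a ^+ k = s ^+ k * x.
    elim: k => [|k IH]; first by rewrite !expg0 mulg1 mul1g.
    by rewrite expgSr mulgA IH -mulgA xs mulgA -expgSr.
  have [p p0 sp] := idempotent_power s.
  (* A letter permutes the finite set [lmul x], so its idempotent power fixes
     every element of this set. *)
  have inj : {in lmul x &, injective (fun t => t * b a)}.
    apply/imset_injP; rewrite -[in X in _ == X](perm a); apply/eqP.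
    congr #|pred_of_set _|; rewrite -imset_comp.
    by apply: eq_imset => u /=; rewrite mulgA.
  have inj_k k : {in lmul x &, injective (fun t => t * b a ^+ k)}.
    elim: k => [|k IH] u v xu xv; first by rewrite !expg0 !mulg1.
    rewrite expgS !mulgA => /IH e; apply: inj => //; apply: e;
      exact: lmul_trans (lmul_mulr _ _) (mem_b a).
  have xp : x * b a ^+ p = x.
    apply: (inj_k p); rewrite ?lmul_refl //.
      by rewrite xk; apply/imsetP; exists (s ^+ p) => //; elim: (p) => // k IH;
        rewrite ?expg0 ?expgS // PM.
    by rewrite xk -mulgA xk mulgA sp.
  have tp : t * b a ^+ p = t.
    by case/imsetP: xt => r _ ->; rewrite -mulgA xp.
  (* As [b a ^+ p] fixes [t], the set [t * U] contains [t * b a ^+ i] for all [i <= p], in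
     particular [t] and [t * b a]. It is again a candidate, so maximality of [t] gives
     [t * U = t]. *)
  pose U := \bigcup_(i < p.+1) b a ^+ (p + i).
  have tU : t * U \in lmul x.
    case/imsetP: xt => r Pr ->; rewrite -mulgA.
    have -> : x * U = (\bigcup_(i < p.+1) s ^+ (p + i)) * x.
      by rewrite mul_bigcupr mul_bigcupl; apply: eq_bigr => i _.
    by rewrite mulgA mem_lmul // PM // Ppow.
  have sub_tU i : (i < p.+1)%N -> t * b a ^+ i \subset t * U.
    move=> lti; rewrite mul_bigcupr (bigcup_max (Ordinal lti)) //=.
    by rewrite expgnDr mulgA tp.
  have t_tU : t \subset t * U by have := sub_tU 0 isT; rewrite expg0 mulg1.
  have Zk k : Z * b a ^+ k \subset Z.
    elim: k => [|k IH]; first by rewrite expg0 mulg1.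
    by rewrite expgS mulgA (subset_trans _ IH) // mulSS.
  have good_tU : good (t * U).
    rewrite /good tU (subset_trans sxt) //= mul_bigcupr.
    apply/bigcupsP=> i _; rewrite (subset_trans (mulSS stZ (subxx _))) //.
    by rewrite -mulgA mulSS.
  have := sub_tU 1%N p0; rewrite expg1 => /subset_trans; apply.
  by have := tmax _ good_tU; rewrite /= (geq_leqif (subset_leqif_card t_tU)).
apply/subsetP=> _ /mulSP[u [v [xu /fiberP[w _ wv] ->]]].
have: u \in t by apply: (subsetP sxt).
elim: w u v wv {xu} => [|a w IH] u v; rewrite !(big_nil, big_cons).
  by rewrite mem_oneS => /eqP-> ; rewrite mulg1.
move=> /mulSP[y [z [by_ wz ->]]] tu; rewrite mulgA; apply: IH => //.
by apply: (subsetP (testbit a)); apply: mem_mulS.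
Qed.

(** Induction on the size of [lmul x], then on the number of letters. If [a] shrinks the ideal,
    words without [a] are handled by the inner induction. The blocks followed by [a] are letters of
    the possibly larger alphabet [N0], but starting from [x * b a] the ideal is smaller and the
    outer induction applies. *)
Lemma aperiodic_covering (A : finType) (b : A -> {set M}) (x : {set M}) :
  (forall a, x * b a \in lmul x) ->
  exists (N : finMonoidType) (g : A -> N),
    aperiodic N /\ forall n, x * fiber b g n \in lmul x.
Proof.
have [k] := ubnP #|lmul x|; elim: k => // k IHk in x A b *; rewrite ltnS => lek.
have [l] := ubnP #|A|; elim: l => // l IHl in A b *; rewrite ltnS => lel xb.
have sub a : lmul (x * b a) \subset lmul x.
  by apply/subsetP=> y /lmul_trans; apply.
have [perm|] := boolP [forall a, lmul (x * b a) == lmul x]; last first.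
  rewrite negb_forall => /existsP[/= a neq].
  pose B : finType := {c : A | c != a}.
  have [||N0 [g0 [ap0 cov0]]] := IHl B (fun c => b (val c)).
  - apply: leq_trans lel; rewrite card_sig (eq_card (B := predC1 a)) // cardC1.
    by rewrite prednK //; apply/card_gt0P; exists a.
  - by move=> c; apply: xb.
  pose Z0 := fiber (fun c : B => b (val c)) g0.
  have [||N1 [iota [ap1 cov1]]] := IHk (x * b a) N0 (fun n => Z0 n * b a).
  - apply: leq_trans lek; apply: proper_card; rewrite properEneq sub andbT.
    exact: neq.
  - move=> n; rewrite mulgA; apply: lmul_mulr.
    have /imsetP[s Ps ->] := xb a; rewrite -mulgA.
    by have /imsetP[r Pr ->] := cov0 n; rewrite mulgA mem_lmul // PM.
  exists (merge iota : finMonoidType), (merge_letter (g0 : B -> N0) iota).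
  split; first exact: merge_aperiodic.
  move=> s; rewrite fiber_merge; case: s => [n|[[y p] z]] /=; first exact: cov0.
  have step X : x * X \in lmul x -> forall y, y \in lmul x -> y * X \in lmul x.
    by move=> xX w xw; apply: lmul_trans (lmul_mulr _ xw) xX.
  rewrite !mulgA; apply: step (cov0 z) _ _.
  apply: lmul_trans (xb a); apply: lmul_trans (cov1 p).
  by apply: lmul_mulr; apply: lmul_mulr; apply: cov0.
have [|t xt et] := @permuting_covering A b x.
  by move=> a; apply/eqP/(forallP perm).
exists trivial_monoid, (fun=> tt); split; first exact: trivial_aperiodic.
by case; rewrite -et.
Qed.

End Covering.

(** * Derivable pairs *)

(** The least such [R] is the submonoid generated by [Z], so [Q] lies in this submonoid. Quantifying
    over subsets makes the condition a bounded one for the decision procedure. *)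
Definition spanned (M : finMonoidType) (Z Q : {set M}) : Prop :=
  forall R : {set M}, 1 \in R -> R * Z \subset R -> Q \subset R.

Inductive derivable (M : finMonoidType) : {set M} -> {set M} -> Prop :=
| derivable_point (m : M) : derivable [set m] set0
| derivable_mul (X V Z W : {set M}) : derivable X V -> derivable Z W ->
  derivable (X * Z) W
(* If [n] witnesses [(Z, W)] in an aperiodic monoid, then [n ^+ p] with
   [n ^+ p.+1 = n ^+ p] witnesses the conclusion. *)
| derivable_pow (Z W Q : {set M}) : derivable Z W -> Q \subset Q * Z ->
  spanned Z Q ->
    derivable Q (W :|: Z)
| derivable_span (Z W W' : {set M}) : derivable Z W -> spanned W W' ->
  derivable Z W'
| derivable_sub (Z W Z' W' : {set M}) : derivable Z W -> Z' \subset Z ->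
  W' \subset W ->
    derivable Z' W'.

Definition covered (M N : finMonoidType) (phi : M -> {set N}) (Y W : {set M}) :=
  exists n : N, Y \subset relinv phi n /\ W \subset relpreim phi (Stab n).

Section Spanned.
Variable M : finMonoidType.
Implicit Types X Y Z Q W : {set M}.

Lemma spannedM Z Q Q' : spanned Z Q -> spanned Z Q' -> spanned Z (Q * Q').
Proof.
move=> ZQ ZQ' R R1 RZ; apply/subsetP=> _ /mulSP[x [y [Qx Q'y ->]]].
have Rx := subsetP (ZQ R R1 RZ) x Qx.
(* The residual of [R] by [x] satisfies the same closure conditions as [R]. *)
pose R' := [set u | x * u \in R].
have /subsetP/(_ y Q'y) : Q' \subset R'; last by rewrite inE.
apply: ZQ'; first by rewrite inE mulg1.
apply/subsetP=> _ /mulSP[u [v [+ Zv ->]]]; rewrite !inE => Ru.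
by apply: (subsetP RZ); rewrite mulgA mem_mulS.
Qed.

Lemma spanned_id Z : spanned Z Z.
Proof.
move=> R R1 /subsetP RZ; apply/subsetP=> z Zz.
by apply: RZ; rewrite -[z]mul1g mem_mulS.
Qed.

Lemma spanned1 Z : spanned Z 1.
Proof. by move=> R R1 _; rewrite sub1set. Qed.

Lemma spannedX Z k : spanned Z (Z ^+ k).
Proof.
elim: k => [|k IH]; first exact: spanned1.
by rewrite expgS; apply: (@spannedM Z Z (Z ^+ k)) IH; apply: spanned_id.
Qed.

Lemma spannedS Z Z' Q : Z \subset Z' -> spanned Z Q -> spanned Z' Q.
Proof.
move=> sZ ZQ R R1 RZ; apply: ZQ => //.
exact: subset_trans (mulSS (subxx _) sZ) RZ.
Qed.

Lemma spanned_bigcup Z (I : finType) (P : pred I) (F : I -> {set M}) :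
  (forall i, P i -> spanned Z (F i)) -> spanned Z (\bigcup_(i | P i) F i).
Proof.
by move=> ZF R R1 RZ; apply/bigcupsP=> i Pi; apply: ZF.
Qed.

End Spanned.

(** * Soundness of the rules *)

Section Soundness.
Variables (M N : finMonoidType) (phi : M -> {set N}).
Hypothesis apN : aperiodic N.
Hypothesis relphi : relational_morphism phi.

Lemma mem_relpreim (S : {set N}) m :
  reflect (exists2 n, n \in S & n \in phi m) (m \in relpreim phi S).
Proof.
apply: (iffP bigcupP) => -[n Sn]; first by rewrite inE; exists n.
by exists n; rewrite ?inE.
Qed.

(** Each rule transports witnesses. A product [n * k] is stabilized by whatever stabilizes [k], so
    [derivable_mul] keeps the second component of the right factor; stabilizers are closed under
    products, which gives [derivable_span]. *)
Lemma derivable_sound Y W : derivable Y W -> covered phi Y W.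
Proof.
have [phi_n0 phi1 phiM] := relphi.
elim=> {Y W} [m|X V Z W _ [n [Xn _]] _ [k [Zk Wk]]|Z W Q _ [n [Zn Wn]] QZ ZQ|
             Z W W' _ [n [Zn Wn]] WW'|Z W Z' W' _ [n [Zn Wn]] sZ sW].
- have /set0Pn[n mn] := phi_n0 m; exists n; rewrite sub0set; split=> //.
  by rewrite sub1set inE.
- exists (n * k); split.
    apply/subsetP=> _ /mulSP[x [z [/(subsetP Xn) xn /(subsetP Zk) zk ->]]].
    by rewrite !inE in xn zk *; apply: phiM.
  apply/subsetP=> w /(subsetP Wk)/mem_relpreim[s]; rewrite inE => /eqP ks ws.
  by apply/mem_relpreim; exists s; rewrite // inE -mulgA ks.
- have [p np] := apN n.
  have npk k : n ^+ (p + k) = n ^+ p.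
    elim: k => [|k IH]; first by rewrite addn0.
    by rewrite addnS expgSr IH -expgSr.
  have powZ q : q \in Q -> exists k, n ^+ k \in phi q.
    pose R := [set m | `[< exists k, n ^+ k \in phi m >]].
    move=> Qq; have /subsetP/(_ q Qq) : Q \subset R; last first.
      by rewrite inE => /asboolP.
    apply: ZQ => //; first by rewrite inE; apply/asboolP; exists 0.
    apply/subsetP=> _ /mulSP[x [z [Rx /(subsetP Zn) zn ->]]].
    rewrite !inE in Rx zn *; move: Rx => /asboolP[k xk]; apply/asboolP.
    by exists k.+1; rewrite expgSr; apply: phiM.
  (* Unrolling [Q \subset Q * Z] [k] times makes the exponent at least [k]; from [p] on, all powers
     of [n] agree. *)
  have powQ k q : q \in Q -> exists i, n ^+ (i + k) \in phi q.
    elim: k q => [|k IH] q Qq.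
      by have [i iq] := powZ q Qq; exists i; rewrite addn0.
    have /mulSP[x [z [/IH[i xi] /(subsetP Zn) zn ->]]] := subsetP QZ q Qq.
    by exists i; rewrite addnS expgSr; apply: phiM => //; rewrite inE in zn.
  have npQ q : q \in Q -> n ^+ p \in phi q.
    by move=> /(powQ p)[i]; rewrite addnC npk.
  exists (n ^+ p); split; first by apply/subsetP=> q /npQ; rewrite inE.
  apply/subsetP=> w /setUP[/(subsetP Wn)/mem_relpreim[t]|/(subsetP Zn)].
    rewrite inE => /eqP nt wt; apply/mem_relpreim; exists t; rewrite // inE.
    by rewrite -(npk 1%N) addn1 expgSr -mulgA nt.
  rewrite inE => wn; apply/mem_relpreim; exists n; rewrite // inE.
  by rewrite -expgSr np.
- exists n; split=> //; apply: WW'.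
    by apply/mem_relpreim; exists 1; rewrite // inE mulg1.
  apply/subsetP=> _ /mulSP[x [w [/mem_relpreim[s Ss xs] /(subsetP Wn) Sw ->]]].
  move: Ss Sw => + /mem_relpreim[t + wt]; rewrite !inE => /eqP ns /eqP nt.
  by apply/mem_relpreim; exists (s * t); [rewrite inE mulgA ns nt | exact: phiM].
- by exists n; rewrite (subset_trans sZ) ?(subset_trans sW).
Qed.

End Soundness.

Section Completeness.
Variable M : finMonoidType.
Implicit Types X Y Z W h s e f : {set M}.

(** Once soundness and completeness are known, these are the sets that are pointlike for aperiodic
    monoids. *)
Definition pointlikes : {set {set M}} := [set Z | `[< derivable Z set0 >]].

Lemma pointlikesP Z : Z \in pointlikes <-> exists W, derivable Z W.
Proof.
rewrite inE; split=> [/asboolP|[W ZW]]; first by exists set0.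
by apply/asboolP; apply: derivable_sub ZW _ _; rewrite ?sub0set.
Qed.

(** The powers from [p] to [2p] form a set [Q] with [Q \subset Q * Z]: each is [Z] times the
    preceding one, and [Z ^+ p], being idempotent, is also the last one. *)
Lemma derivable_pow_bigcup Z W p : 0 < p -> derivable Z W ->
  Z ^+ p * Z ^+ p = Z ^+ p ->
  derivable (\bigcup_(i < p.+1) Z ^+ (p + i)) (W :|: Z).
Proof.
case: p => // p _ ZW idem; apply: derivable_pow => //.
  rewrite mul_bigcupl; apply/bigcupsP=> -[[|i] lti] _ /=.
    rewrite addn0 (bigcup_max (Ordinal (leqnSn p.+1))) //=.
    by rewrite -expgSr -addnS expgnDr idem.
  by rewrite (bigcup_max (Ordinal (ltnW lti))) //= -expgSr addnS.
by apply: spanned_bigcup => i _; apply: spannedX.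
Qed.

(** * Monoids of pointlike sets with linearly ordered left ideals *)

Section Chain.
Variable H : {set {set M}}.
Hypothesis H1 : 1 \in H.
Hypothesis HM : forall h k, h \in H -> k \in H -> h * k \in H.
Hypothesis Hpt : forall h, h \in H -> h \in pointlikes.

Local Notation lideal h := (lmul H h).
Hypothesis Htotal : forall h k, h \in H -> k \in H ->
  h \in lideal k \/ k \in lideal h.

Let lideal_trans x y z : x \in lideal y -> y \in lideal z -> x \in lideal z.
Proof. exact: lmul_trans. Qed.

Let HX h k : h \in H -> h ^+ k \in H.
Proof. by move=> Hh; elim: k => [|k IH]; rewrite ?expg0 ?expgS ?HM. Qed.

Let derivable_lideal h k W : derivable h W -> k \in lideal h -> derivable k W.
Proof.
move=> hW /imsetP[z Hz ->]; have /pointlikesP[V zV] := Hpt Hz.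
exact: derivable_mul zV hW.
Qed.

(* Since left ideals are linearly ordered, [e = z s] forces [e z = e z e], hence
   [e = (e z) ^ i e s ^ i]. *)
Lemma idempotent_lideal e s : e \in H -> s \in H -> e * e = e -> e \in lideal s ->
  forall k, e \in lideal (s ^+ k).
Proof.
move=> He Hs ee /imsetP[z Hz ez] k.
have le_card a b : a \in lideal b -> lideal a \subset lideal b.
  by move=> ab; apply/subsetP=> c /lideal_trans; apply.
have eze : e * z * e = e * z.
  have /imsetP[y Hy ->] : e * z \in lideal e; last by rewrite -mulgA ee.
  (* Otherwise [lideal e] lies in [lideal (e * z)], which is its image under right multiplication by
     [z] and hence no larger; the two ideals coincide. *)
  have [//|eez] := Htotal (HM He Hz) He.
  have sub := le_card _ _ eez.
  have -> : lideal e = lideal (e * z).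
    apply/eqP; rewrite eqEcard sub /=.
    have -> : lideal (e * z) = [set t * z | t in lideal e].
      by rewrite -imset_comp; apply: eq_imset => t /=; rewrite mulgA.
    exact: leq_imset_card.
  exact: lmul_refl.
have ek i : e = (e * z) ^+ i * e * s ^+ i.
  elim: i => [|i IH]; first by rewrite !expg0 mul1g mulg1.
  rewrite {1}IH -{2}ee {3}ez expgSr expgS !mulgA; congr (_ * _).
  by rewrite -[in RHS](mulgA _ e z) -[in RHS](mulgA _ (e * z) e) eze !mulgA.
by rewrite [X in X \in _](ek k); apply: mem_lmul; rewrite HM ?HX ?HM.
Qed.

(** The second component has absorbed every element of [H] whose left ideal contains [e]. *)
Definition saturated e :=
  exists2 W, derivable e W & forall s, s \in H -> e \in lideal s -> spanned W s.

(** It remains to absorb the elements [s] with the same left ideal as [e], one at a time. From [e]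
    one passes to its left multiple [s], takes the union of powers of [s], which adds [s] to the
    second component, and returns to [e], a left multiple of [s ^+ p]. *)
Lemma saturate e W : e \in H -> e * e = e -> derivable e W ->
  (forall s, s \in H -> s \notin lideal e -> spanned W s) -> saturated e.
Proof.
move=> He ee eW upW.
have step (l : seq {set M}) :
    (forall s, s \in l -> [/\ s \in H, s \in lideal e & e \in lideal s]) ->
  exists W', [/\ derivable e W', W \subset W' & forall s, s \in l ->
    s \subset W'].
  elim: l => [|s l IH] sl; first by exists W.
  have [|W' [eW' sW' lW']] := IH.
    by move=> t tl; apply: sl; rewrite inE tl orbT.
  have [Hs se es] := sl s (mem_head _ _).
  have [p p0 idem] := idempotent_power s.
  have dpow := derivable_pow_bigcup p0 (derivable_lideal eW' se) idem.
  have /imsetP[x Hx ex] := idempotent_lideal He Hs ee es p.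
  have /pointlikesP[V xV] := Hpt Hx.
  exists (W' :|: s); split; last 1 first.
  - move=> t; rewrite inE => /predU1P[->|/lW' tW']; first exact: subsetUr.
    exact: subset_trans tW' (subsetUl _ _).
  - apply: derivable_sub (derivable_mul xV dpow) _ (subxx _).
    rewrite {1}ex; apply: mulSS => //.
    by rewrite (bigcup_max ord0) //= addn0.
  - exact: subset_trans sW' (subsetUl _ _).
have [|W' [eW' sW' lW']] :=
  step [seq s <- enum H | (s \in lideal e) && (e \in lideal s)].
  by move=> s; rewrite mem_filter mem_enum => /andP[/andP[se es] Hs].
exists W' => // s Hs es; have [se|nse] := boolP (s \in lideal e).
  have sW's : s \subset W' by apply: lW'; rewrite mem_filter mem_enum se es.
  exact: spannedS sW's (@spanned_id _ _).
exact: spannedS sW' (upW s Hs nse).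
Qed.

(* An element of [H] is either in the span of the elements above [h] and of [h]
   itself, or a left multiple of every power of [h]. *)
Lemma saturate_below f h : f \in H -> h \in H -> saturated f ->
  f \notin lideal h ->
    (forall s, s \in H -> f \in lideal s \/ s \in lideal h) ->
  exists e, [/\ e \in H, saturated e & e \in lideal h].
Proof.
move=> Hf Hh [W fW upW] nfh fh.
have hf : h \in lideal f by case: (Htotal Hf Hh) => // fh'; rewrite fh' in nfh.
have [p p0 idem] := idempotent_power h.
have dpow := derivable_pow_bigcup p0 (derivable_lideal fW hf) idem.
have spanH k s : s \in H -> spanned (W :|: h) s \/ s \in lideal (h ^+ k).
  elim: k s => [|k IH] s Hs.
    by right; apply/imsetP; exists s; rewrite // expg0 mulg1.
  have [|/imsetP[y Hy ->]] := IH s Hs; first by left.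
  have [fy|/imsetP[y' Hy' ->]] := fh y Hy; [left|right].
    apply: spannedM; first exact: spannedS (subsetUl _ _) (upW y Hy fy).
    by apply: spannedS (subsetUr _ _) _; apply: spannedX.
  by rewrite -mulgA -expgS; apply: mem_lmul.
exists (h ^+ p); split; first exact: HX.
  apply: saturate (HX _ Hh) idem _ _ => [|s Hs nsh].
    apply: derivable_sub dpow _ (subxx _).
    by rewrite (bigcup_max ord0) //= addn0.
  by have [//|sh] := spanH p s Hs; rewrite sh in nsh.
by case: p p0 {idem dpow} => // p _; rewrite expgSr; apply: mem_lmul (HX _ Hh).
Qed.

(** Take a saturated [f] with the smallest left ideal. If some left ideal of [H] misses [f], take
    the largest such ideal [lideal h]; [saturate_below] then yields a saturated element inside it,
    contradicting minimality. *)
Lemma derivable_chain : exists2 f, f \in H & derivable f (\bigcup_(h in H) h).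
Proof.
pose good f := (f \in H) && `[< saturated f >].
(* The descent starts at [1], whose left ideal is all of [H]. *)
have good1 : good 1.
  rewrite /good H1; apply/asboolP; apply: (@saturate _ set0) => //.
  - exact: mulg1.
  - exact: derivable_point.
  by move=> s Hs; rewrite -[s in s \notin _]mulg1 mem_lmul.
have [f /andP[Hf /asboolP satf] fmin] := arg_minnP (fun f => #|lideal f|) good1.
exists f => //; have [W fW upW] := satf.
suff low s : s \in H -> f \in lideal s.
  apply: derivable_span fW _; apply: spanned_bigcup => s Hs.
  by apply: upW => //; apply: low.
move=> Hs; apply/negPn/negP => nfs.
pose below h := (h \in H) && (f \notin lideal h).
have below_s : below s by rewrite /below Hs.
have [h /andP[Hh nfh] hmax] := arg_maxnP (fun h => #|lideal h|) below_s.
have sub a b : a \in lideal b -> lideal a \subset lideal b.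
  by move=> ab; apply/subsetP=> c /lideal_trans; apply.
have [|e [He sate eh]] := saturate_below Hf Hh satf nfh.
  move=> t Ht; have [|nft] := boolP (f \in lideal t); [by left|right].
  have [//|/sub ht] := Htotal Ht Hh.
  have /eqP -> : lideal h == lideal t.
    by rewrite eqEcard ht; apply: hmax; rewrite /below Ht.
  exact: lmul_refl.
have hf : h \in lideal f by case: (Htotal Hf Hh) => // fh; rewrite fh in nfh.
have := fmin e; rewrite /good He /= => /(_ (asboolT sate)); rewrite leqNgt =>
  /negP[].
apply: proper_card; apply/properP; split; first exact: sub (lideal_trans eh hf).
exists f; first exact: lmul_refl.
by apply/negP => /lideal_trans/(_ eh) fh; rewrite fh in nfh.
Qed.

End Chain.
End Completeness.

(** * Completeness *)

Section Submonoid.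
Variables (N : finMonoidType) (I : {set N}) (clI : monoid_closed (mem I)).

(** The closure proof is an argument of the type, so that the monoid instance can recover it. *)
Definition submonoid_of of monoid_closed (mem I) : Type := {n : N | n \in I}.
Local Notation submonoid := (submonoid_of clI).
HB.instance Definition _ := Finite.on submonoid.

Let cl1 : 1 \in I. Proof. by case: clI. Qed.
Let clM (x y : submonoid) : val x * val y \in I.
Proof. by case: clI => _; apply; apply: valP. Qed.

Definition submonoid_one : submonoid := Sub 1 cl1.
Definition submonoid_mul (x y : submonoid) : submonoid :=
  Sub (val x * val y) (clM x y).

Lemma submonoid_mulA : associative submonoid_mul.
Proof. by move=> x y z; apply: val_inj; rewrite /= mulgA. Qed.
Lemma submonoid_mul1 : left_id submonoid_one submonoid_mul.
Proof. by move=> x; apply: val_inj; rewrite /= mul1g. Qed.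
Lemma submonoid_mulr1 : right_id submonoid_one submonoid_mul.
Proof. by move=> x; apply: val_inj; rewrite /= mulg1. Qed.

HB.instance Definition _ :=
  isMonoid.Build submonoid submonoid_mulA submonoid_mul1 submonoid_mulr1.

Lemma val_submonoidM (x y : submonoid) : val (x * y) = val x * val y.
Proof. by []. Qed.

Lemma submonoid_aperiodic : aperiodic N -> aperiodic submonoid.
Proof.
move=> apN x; have [n xn] := apN (val x); exists n; apply: val_inj.
have valX k : val (x ^+ k) = val x ^+ k.
  by elim: k => // k IH; rewrite !expgS val_submonoidM IH.
by rewrite !valX.
Qed.

End Submonoid.

(** A nonprincipal ultrafilter, obtained by extending the filter of eventual properties. *)
Lemma nat_ultrafilter : exists U : (nat -> Prop) -> Prop,
  [/\ forall P Q : nat -> Prop, (forall i, P i -> Q i) -> U P -> U Q,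
      forall P Q : nat -> Prop, U P -> U Q -> U (fun i => P i /\ Q i),
      forall P : nat -> Prop, U P \/ U (fun i => ~ P i),
      ~ U (fun=> False) &
      forall k, U (fun i => (k <= i)%N)].
Proof.
have [G [ultraG leG]] :=
  @filter.ultraFilterLemma nat filter.eventually filter.eventually_filter.
have properG := filter.ultra_proper (UltraFilter := ultraG).
have filterG := filter.filter_filter (ProperFilter := properG).
exists G; split.
- by move=> P Q PQ; apply: filter.filterS.
- by move=> P Q; apply: filter.filterI.
- by move=> P; apply: filter.in_ultra_setVsetC.
- exact: filter.filter_not_empty.
by move=> k; apply: leG; exists k.
Qed.

(** Compactness: otherwise every [t] fails from some level on, and all of them fail at the maximum
    of these levels. *)
Lemma finite_decreasing (T : finType) (G : nat -> T -> Prop) :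
  (forall k t, G k.+1 t -> G k t) -> (forall k, exists t, G k t) ->
  exists t, forall k, G k t.
Proof.
move=> decG exG; apply: contrapT => /forallNP noG.
have /choice[f fG] : forall t, exists k, ~ G k t.
  by move=> t; apply/existsNP; apply: noG.
have [t Gt] := exG (\max_t f t); case: (fG t); move: Gt.
have /subnK <- : (f t <= \max_t f t)%N by apply: leq_bigmax.
by elim: (_ - _)%N => // i IH /decG.
Qed.

Section Completeness.
Variable M : finMonoidType.
Local Notation word := (seq M).
Local Notation eval u := (\big[*%g/(1 : M)]_(a <- u) a).

(** A morphism from words over the alphabet [M] to an aperiodic monoid. Relating [eval u] to the
    value of [u] turns it into a relational morphism. *)
Record recognizer := Recognizer {
  rmonoid :> finMonoidType;
  rmap : M -> rmonoid;
  raperiodic : aperiodic rmonoid }.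

Implicit Types (r : recognizer) (u v : word) (k : nat).

Definition req r u v := word_prod (rmap r) u = word_prod (rmap r) v.

(* The elements of the image of [rmap r] form a submonoid; restricting to it
   provides a word [c] even when [Y] is empty. *)
Lemma covered_word r (Y W : {set M}) :
  (forall (N : finMonoidType) (phi : M -> {set N}),
      aperiodic N -> relational_morphism phi -> covered phi Y W) ->
  exists c, (forall y, y \in Y -> exists2 u, req r u c & eval u = y) /\
            (forall w, w \in W -> exists2 s, req r (c ++ s) c & eval s = w).
Proof.
move=> covYW; pose psi u := word_prod (rmap r) u.
have psiM u v : psi (u ++ v) = psi u * psi v by rewrite /psi big_cat.
pose I := [set n | `[< exists u, psi u = n >]].
have clI : monoid_closed (mem I).
  split=> [|_ _ /[!inE] /asboolP[u <-] /asboolP[v <-]].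
    by rewrite inE; apply/asboolP; exists [::]; rewrite /psi big_nil.
  by apply/asboolP; exists (u ++ v).
pose N : finMonoidType := submonoid_of clI.
pose phi m : {set N} := [set n : N | `[< exists2 u,
  psi u = val n & eval u = m >]].
have psiI u : psi u \in I by rewrite inE; apply/asboolP; exists u.
have relphi : relational_morphism phi.
  split=> [m||m m' n n'].
  - apply/set0Pn; exists (exist (fun n => n \in I) _ (psiI [:: m]) : N).
    by rewrite inE; apply/asboolP; exists [:: m]; rewrite ?big_seq1.
  - by rewrite inE; apply/asboolP; exists [::]; rewrite /psi !big_nil.
  rewrite !inE => /asboolP[u un um] /asboolP[v vn vm]; apply/asboolP.
  by exists (u ++ v); rewrite ?psiM ?un ?vn // big_cat /= um vm.
have [n [Yn Wn]] := covYW N phi (submonoid_aperiodic (@raperiodic r)) relphi.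
have := valP n; rewrite inE => /asboolP[c cn].
exists c; split=> [y /(subsetP Yn)|w /(subsetP Wn)/mem_relpreim[t]].
  by rewrite !inE => /asboolP[u un uy]; exists u; rewrite // /req -/(psi _) un.
rewrite !inE => /eqP nt /asboolP[s st sw]; exists s => //.
by rewrite /req -!/(psi _) psiM cn st -val_submonoidM nt.
Qed.

(** The covering starts from [1] with each letter [m] standing for [[set m]]; the closure conditions
    on the pointlike sets are derivation rules. *)
Lemma henckell : exists r, forall n : r,
  [set m | `[< exists2 u,
    word_prod (rmap r) u = n & eval u = m >]] \in pointlikes M.
Proof.
have [||||N [g [apN cov]]] := @aperiodic_covering M (pointlikes M) _ _ _
  M (fun m => [set m]) 1.
- apply/pointlikesP; exists set0; exact: derivable_point.
- move=> X Y /pointlikesP[V XV] /pointlikesP[W YW].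
  by apply/pointlikesP; exists W; apply: derivable_mul XV YW.
- move=> X p p0 /pointlikesP[W XW] idem; apply/pointlikesP.
  by exists (W :|: X); apply: derivable_pow_bigcup.
- by move=> m; apply/imsetP; exists [set m]; rewrite ?mul1g ?mulg1 //;
  apply/pointlikesP;
    exists set0; apply: derivable_point.
exists (Recognizer g apN) => n /=; have /imsetP[X PX e] := cov n.
rewrite mul1g mulg1 in e; rewrite [X in X \in _](_ : _ = X) // -e.
apply/setP=> m; rewrite !inE; apply/asboolP/asboolP => -[u un um]; exists u => //.
  by rewrite word_prod_set1 um set11.
by move: um; rewrite word_prod_set1 => /set1P.
Qed.

Definition refine r : recognizer :=
  Recognizer (fun a => (rmap r a, [set (1, rmap r a); (rmap r a, 1)]) : schutz r)
             (schutz_aperiodic (@raperiodic r)).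

Lemma refine_split r u v x y : req (refine r) u v -> u = x ++ y ->
  exists x' y', [/\ v = x' ++ y', req r x x' & req r y y'].
Proof.
rewrite /req /= => e exy; have [_ Ru] := schutz_word (rmap r) u.
have [_ Rv] := schutz_word (rmap r) v.
(* The empty word is treated apart, since it is the only word that records no factorization. *)
have [u0|/eqP u0] := eqVneq u [::].
  have v0 : v = [::].
    apply: contrapT => v0; have /Rv : v <> [::] /\ exists u' v', v = u' ++ v' /\
        (word_prod (rmap r) v, 1) = (word_prod (rmap r) u',
          word_prod (rmap r) v').
      by split=> //; exists v, [::]; rewrite cats0 big_nil.
    by rewrite -e => /Ru[].
  exists [::], [::]; move: exy; rewrite u0 v0.
  by case: x => //; case: y.
have /Ru : u <> [::] /\ exists u' v', u = u' ++ v' /\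
    (word_prod (rmap r) x, word_prod (rmap r) y) =
    (word_prod (rmap r) u', word_prod (rmap r) v').
  by split=> //; exists x, y.
by rewrite e => /Rv[_ [x' [y' [-> [ex ey]]]]]; exists x', y'.
Qed.

Lemma refine_nil r u : req (refine r) u [::] -> u = [::].
Proof.
rewrite /req /= => e; apply: contrapT => u0.
have [_ Ru] := schutz_word (rmap r) u.
have /Ru : u <> [::] /\ exists u' v', u = u' ++ v' /\
    (word_prod (rmap r) u, 1) = (word_prod (rmap r) u', word_prod (rmap r) v').
  by split=> //; exists u, [::]; rewrite cats0 big_nil.
by rewrite e big_nil /= inE.
Qed.

(** * Iterated refinements and the ultraproduct of words *)

Section Tower.
Variable r0 : recognizer.
Definition tower k : recognizer := iter k refine r0.
Definition sim k u v := req (tower k) u v.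

Lemma sim_sym k u v : sim k u v -> sim k v u. Proof. exact: esym. Qed.

Lemma sim_trans k u v w : sim k u v -> sim k v w -> sim k u w.
Proof. exact: etrans. Qed.

Lemma sim_cat k u u' v v' : sim k u u' -> sim k v v' -> sim k (u ++ v) (u' ++ v').
Proof. by rewrite /sim /req !big_cat => -> ->. Qed.

Lemma sim_split k u v x y : sim k.+1 u v -> u = x ++ y ->
  exists x' y', [/\ v = x' ++ y', sim k x x' & sim k y y'].
Proof. exact: refine_split. Qed.

Lemma simW k u v : sim k.+1 u v -> sim k u v.
Proof.
move=> /sim_split/(_ (esym (cats0 u)))[x [y [-> ux ey]]].
by rewrite -[u]cats0; apply: sim_cat.
Qed.

Lemma sim_leq k l u v : (k <= l)%N -> sim l u v -> sim k u v.
Proof. by move=> /subnK <-; elim: (_ - _)%N => // i IH /simW. Qed.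

(** The factorization of [c ++ s] lifts to a factorization [x ++ y] of [c ++ t], with [x] equivalent
    to [c] and [y] to [s]. Of the two prefixes [x] and [c] of the same word one extends the other,
    and [z] is the difference. *)
Lemma sim_common_suffix k c s t : sim k.+1 (c ++ s) (c ++ t) ->
  exists z, sim k (c ++ z) c /\ (sim k s (z ++ t) \/ sim k t (z ++ s)).
Proof.
move=> /sim_split/(_ erefl)[x [y [e cx sy]]].
have [lt|gt] := leqP (size x) (size c).
  have ec : c = x ++ drop (size x) c.
    have := congr1 (take (size x)) e;
      rewrite (take_size_cat y erefl) takel_cat // => e'.
    by rewrite -[LHS](cat_take_drop (size x)) e'.
  exists (drop (size x) c); split.
    by rewrite [X in sim k _ X]ec; apply: sim_cat.
  left; suff -> : drop (size x) c ++ t = y by [].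
  by move: e; rewrite {1}ec -catA => /eqP; rewrite eqseq_cat // eqxx => /eqP.
have ex : x = c ++ drop (size c) x.
  have := congr1 (take (size c)) e.
  rewrite (take_size_cat t erefl) takel_cat; last exact: ltnW.
  by move=> e'; rewrite -[LHS](cat_take_drop (size c)) -e'.
exists (drop (size c) x); rewrite -ex; split; first exact: sim_sym.
right; suff -> : t = drop (size c) x ++ y by apply: sim_cat => //; apply: sim_sym.
by move: e; rewrite {1}ex -catA => /eqP; rewrite eqseq_cat // eqxx => /eqP.
Qed.

(** In the ultraproduct [z] is chosen at each index before the level is fixed, so one [z] must serve
    all levels up to [i]: the one for the highest level at which both hypotheses hold. *)
Lemma sim_common_suffix_below i c s t : exists z, forall k, (k <= i)%N ->
  sim k.+1 (c ++ s) c -> sim k.+1 (c ++ t) c ->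
  sim k (c ++ z) c /\ (sim k s (z ++ t) \/ sim k t (z ++ s)).
Proof.
elim: i => [|i [z IH]].
  have [[cs ct]|no] := pselect (sim 1 (c ++ s) c /\ sim 1 (c ++ t) c).
    have [z cz] := sim_common_suffix (sim_trans cs (sim_sym ct)).
    by exists z => k; rewrite leqn0 => /eqP->.
  by exists [::] => k; rewrite leqn0 => /eqP-> cs ct; case: no.
have [[cs ct]|no] := pselect (sim i.+2 (c ++ s) c /\ sim i.+2 (c ++ t) c).
  have [y [cy sty]] := sim_common_suffix (sim_trans cs (sim_sym ct)).
  exists y => k le _ _; split; first exact: sim_leq cy.
  by case: sty => sty; [left|right]; apply: sim_leq sty.
exists z => k; rewrite leq_eqVlt => /predU1P[-> cs ct|]; last exact: IH.
by case: no.
Qed.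

Variable U : (nat -> Prop) -> Prop.
Hypothesis US : forall P Q : nat -> Prop, (forall i, P i -> Q i) -> U P -> U Q.
Hypothesis UI : forall P Q : nat -> Prop, U P -> U Q -> U (fun i => P i /\ Q i).
Hypothesis UC : forall P : nat -> Prop, U P \/ U (fun i => ~ P i).
Hypothesis U0 : ~ U (fun=> False).
Hypothesis Ugeq : forall k, U (fun i => (k <= i)%N).

Local Notation limword := (nat -> word).
Implicit Types (x y z s t c : limword).

Lemma UT (P : nat -> Prop) : (forall i, P i) -> U P.
Proof. by move=> allP; apply: US (Ugeq 0) => i _. Qed.

(** If no single [a] worked, the finitely many negations would hold together on a set of [U]. *)
Lemma U_exists (T : finType) (Q : T -> nat -> Prop) :
  U (fun i => exists a, Q a i) -> exists a, U (Q a).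
Proof.
move=> exQ; apply: contrapT => /forallNP noU; apply: U0.
have : U (fun i => forall a, a \in enum T -> ~ Q a i).
  elim: (enum T) => [|t l IH]; first exact: UT.
  have [/noU//|nQ] := UC (Q t).
  by apply: US (UI nQ IH) => i [nQt nQl] t'; rewrite inE => /predU1P[->|/nQl].
move=> nQ; apply: US (UI exQ nQ) => i [[t Qt] nQi].
by apply: (nQi t); rewrite ?mem_enum.
Qed.

Definition limeq x y := forall k, U (fun i => sim k (x i) (y i)).
Definition limcat x y : limword := fun i => x i ++ y i.
(** The elements that no level separates from [x]: almost every [x i] is equivalent to a word of
    value [m], and this word may vary with the level and the index. *)
Definition limval x : {set M} :=
  [set m | `[< forall k, U (fun i => exists2 u, sim k u (x i) & eval u = m) >]].

Lemma limvalP x m : m \in limval x <->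
  forall k, U (fun i => exists2 u, sim k u (x i) & eval u = m).
Proof. by rewrite inE; split=> /asboolP. Qed.

Lemma limeq_trans x y z : limeq x y -> limeq y z -> limeq x z.
Proof.
move=> xy yz k; apply: US (UI (xy k) (yz k)) => i [].
exact: sim_trans.
Qed.

Lemma limeq_sym x y : limeq x y -> limeq y x.
Proof. by move=> xy k; apply: US (xy k) => i /sim_sym. Qed.

Lemma limval_sub x y : limeq x y -> limval x \subset limval y.
Proof.
move=> xy; apply/subsetP=> m /limvalP xm; apply/limvalP=> k.
apply: US (UI (xm k) (xy k)) => i [[u ux um] xyi]; exists u => //.
exact: sim_trans ux xyi.
Qed.

Lemma limval_eq x y : limeq x y -> limval x = limval y.
Proof.
by move=> xy; apply/eqP; rewrite eqEsubset !limval_sub //; apply: limeq_sym.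
Qed.

Lemma limvalM x y : limval (limcat x y) = limval x * limval y.
Proof.
apply/setP=> m; apply/idP/idP => [/limvalP xym|].
  (* The splitting of [m] depends on the index and on the level; [U_exists] makes it constant over
     the indices and [finite_decreasing] over the levels. *)
  pose G k (t : M * M) := U (fun i =>
    [/\ t.1 * t.2 = m, exists2 u, sim k u (x i) & eval u = t.1
     & exists2 v, sim k v (y i) & eval v = t.2]).
  have [t Gt] : exists t : M * M, forall k, G k t.
    apply: finite_decreasing => [k t|k].
      by apply: US => i [tm [u /simW ux ut] [v /simW vy vt]];
        split=> //; [exists u|exists v].
    apply: U_exists; apply: US (xym k.+1) => i [u /sim_sym /sim_split].
    move=> /(_ _ _ erefl)[u' [v' [-> xu yv]]] uv.
    exists (eval u', eval v'); rewrite -uv big_cat; split=> //=.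
      by exists u' => //; apply: sim_sym.
    by exists v' => //; apply: sim_sym.
  apply/mulSP; exists t.1, t.2; split.
  - by apply/limvalP=> k; apply: US (Gt k) => i [].
  - by apply/limvalP=> k; apply: US (Gt k) => i [].
  apply: contrapT => tm; apply: U0; apply: US (Gt 0) => i [e _ _].
  by rewrite e in tm.
move=> /mulSP[a [b [/limvalP xa /limvalP yb ->]]]; apply/limvalP=> k.
apply: US (UI (xa k) (yb k)) => i [[u ux <-] [v vy <-]].
by exists (u ++ v); [apply: sim_cat | rewrite big_cat].
Qed.

Lemma limval_nil : limval (fun=> [::]) = 1.
Proof.
apply/setP=> m; rewrite mem_oneS; apply/idP/eqP => [/limvalP/(_ 1%N) nm|->].
  apply: contrapT => m1; apply: U0; apply: US nm => i [u /refine_nil-> e].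
  by rewrite big_nil in e; rewrite -e in m1.
by apply/limvalP=> k; apply: UT => i; exists [::]; rewrite ?big_nil.
Qed.

Lemma limeq_common_suffix c s t : limeq (limcat c s) c -> limeq (limcat c t) c ->
  exists2 z, limeq (limcat c z) c &
             limeq s (limcat z t) \/ limeq t (limcat z s).
Proof.
move=> cs ct.
have /choice[z Hz] := fun i => sim_common_suffix_below i (c i) (s i) (t i).
have {}Hz k : U (fun i => sim k (c i ++ z i) (c i) /\
    (sim k (s i) (z i ++ t i) \/ sim k (t i) (z i ++ s i))).
  apply: US (UI (Ugeq k) (UI (cs k.+1) (ct k.+1))) => i [ki [csi cti]].
  exact: Hz.
exists z; first by move=> k; apply: US (Hz k) => i [].
(* If one alternative fails at level [k] and the other at level [l], both fail at [maxn k l] on a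
   set of [U], against [Hz]. *)
apply: contrapT => /not_orP[/existsNP[k nk] /existsNP[l nl]].
have [//|{}nk] := UC (fun i => sim k (s i) (limcat z t i)).
have [//|{}nl] := UC (fun i => sim l (t i) (limcat z s i)).
apply: U0; apply: US (UI (Hz (maxn k l)) (UI nk nl)) => i [[_ h] [nki nli]].
by case: h => [/(sim_leq (leq_maxl k l))|/(sim_leq (leq_maxr k l))].
Qed.

Hypothesis r0P : forall n : r0,
  [set m | `[< exists2 u,
    word_prod (rmap r0) u = n & eval u = m >]] \in pointlikes M.

(** The values of the [x i] in the finite monoid [r0] are constant on a set of [U], so [limval x]
    lies in a single fibre of [r0]. *)
Lemma limval_pointlike x : limval x \in pointlikes M.
Proof.
pose F (n : r0) : {set M} :=
  [set m | `[< exists2 u, word_prod (rmap r0) u = n & eval u = m >]].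
have [n Un] : exists n : r0, U (fun i => word_prod (rmap r0) (x i) = n).
  by apply: U_exists; apply: UT => i; exists (word_prod (rmap r0) (x i)).
have sub : limval x \subset F n.
  apply/subsetP=> m /limvalP/(_ 0) xm; rewrite inE; apply/asboolP.
  apply: contrapT => nm; apply: U0; apply: US (UI Un xm) => i [xn [u ux um]].
  by apply: nm; exists u => //; rewrite -xn.
have /pointlikesP[W FW] := r0P n; apply/pointlikesP; exists W.
exact: derivable_sub FW sub (subxx _).
Qed.

(** [derivable_chain] applies to the values [H] of the stabilizer of [c] and gives a pair whose
    first component is some [limval x] with [x] in this stabilizer. Multiplying on the left by
    [limval c] turns it into [limval c], because [c x = c]. *)
Lemma derivable_limit c (Y W : {set M}) : Y \subset limval c ->
  (forall w, w \in W -> exists2 s, limeq (limcat c s) c & w \in limval s) ->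
  derivable Y W.
Proof.
move=> Yc Wc.
pose H : {set {set M}} :=
  [set Z | `[< exists2 s, limeq (limcat c s) c & limval s = Z >]].
have memH s : limeq (limcat c s) c -> limval s \in H.
  by move=> cs; rewrite inE; apply/asboolP; exists s.
have [||||f] := @derivable_chain M H.
- rewrite -limval_nil; apply: memH => k; apply: UT => i.
  by rewrite /limcat cats0.
- move=> _ _ /[!inE] /asboolP[s cs <-] /asboolP[t ct <-].
  apply/asboolP; exists (limcat s t); last exact: limvalM.
  apply: limeq_trans ct => k.
  by apply: US (cs k) => i csi; rewrite /limcat catA; apply: sim_cat.
- by move=> h /[!inE] /asboolP[s _ <-]; have := limval_pointlike s; rewrite inE.
- move=> _ _ /[!inE] /asboolP[s cs <-] /asboolP[t ct <-].
  have [z cz [sz|tz]] := limeq_common_suffix cs ct; [left|right].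
    by rewrite (limval_eq sz) limvalM; apply: mem_lmul (memH _ cz).
  by rewrite (limval_eq tz) limvalM; apply: mem_lmul (memH _ cz).
rewrite inE => /asboolP[x cx <-] xH.
have /pointlikesP[V cV] := limval_pointlike c.
apply: derivable_sub (derivable_mul cV xH) _ _.
  by rewrite -limvalM (limval_eq cx).
apply/subsetP=> w /Wc[s cs ws]; apply/bigcupP.
by exists (limval s) => //; apply: memH.
Qed.

End Tower.

(** The words that [covered_word] provides for the successive levels form one limit word: what holds
    at level [i] holds at level [k] for all [i >= k], hence almost everywhere. *)
Theorem derivable_complete (Y W : {set M}) :
  (forall (N : finMonoidType) (phi : M -> {set N}),
      aperiodic N -> relational_morphism phi -> covered phi Y W) ->
  derivable Y W.
Proof.
move=> covYW; have [r0 r0P] := henckell.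
have [U [US UI UC U0 Ugeq]] := nat_ultrafilter.
have /choice[c Hc] := fun k => covered_word (tower r0 k) covYW.
apply: (derivable_limit US UI UC U0 Ugeq r0P (c := c)).
  apply/subsetP=> y Yy; apply/limvalP=> k; apply: US (Ugeq k) => i ki.
  have [+ _] := Hc i; move=> /(_ y Yy)[u uc uy]; exists u => //.
  exact: sim_leq uc.
move=> w Ww; have /choice[s Hs] : forall k, exists u,
    sim r0 k (c k ++ u) (c k) /\ eval u = w.
  by move=> k; have [_ /(_ w Ww)[u cu uw]] := Hc k; exists u.
exists s => [k|].
  by apply: US (Ugeq k) => i ki; have [+ _] := Hs i; apply: sim_leq.
apply/limvalP=> k; apply: (UT US Ugeq) => i; have [_ sw] := Hs i.
by exists (s i).
Qed.

Theorem covered_derivable (Y W : {set M}) :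
  (forall (N : finMonoidType) (phi : M -> {set N}),
      aperiodic N -> relational_morphism phi -> covered phi Y W) <->
  derivable Y W.
Proof.
split; first exact: derivable_complete.
by move=> YW N phi apN relphi; apply: derivable_sound.
Qed.

End Completeness.

Local Close Scope group_scope.

(** * Recursive functions *)

(* Nested pairs rather than tuples, so that variables are [v.1], [v.2.1], ...
   and a binder only adds a component in front. *)
Fixpoint env k : Type := if k is k'.+1 then (nat * env k')%type else unit.

Fixpoint env_of k (s : seq nat) : env k :=
  if k is k'.+1 return env k then (head 0 s, env_of k' (behead s)) else tt.

Definition Rec k (f : env k -> nat) : Prop :=
  recursive (fun v : k.-tuple nat => f (env_of k v)).

Definition RecB k (p : env k -> bool) : Prop := Rec (fun v => nat_of_bool (p v)).

Lemma Rec_ext k (f g : env k -> nat) : f =1 g -> Rec f -> Rec g.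
Proof. by move=> fg; apply: rec_ext => v /=. Qed.

Lemma Rec_comp k m (f : env m -> nat) (g : 'I_m -> env k -> nat) :
  Rec f -> (forall i, Rec (g i)) ->
  Rec (fun v => f (env_of m [seq g i v | i <- enum 'I_m])).
Proof.
by move=> Rf Rg; apply: rec_ext (rec_comp Rf Rg) => v.
Qed.

Lemma Rec_tail k (f : env k -> nat) : Rec f -> Rec (fun v : env k.+1 => f v.2).
Proof.
move=> Rf; apply: rec_ext (rec_comp Rf (fun i => rec_proj (lift ord0 i))) => v /=.
congr (f (env_of _ _)); case/tupleP: v => x v /=.
by rewrite (eq_map (tnthS x v)) map_tnth_enum.
Qed.

(** In the body of a recursion the accumulator stands between the index and the context; this
    weakening serves bodies that ignore it. *)
Lemma Rec_skip k (f : env k.+1 -> nat) :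
  Rec f -> Rec (fun v : env k.+2 => f (v.1, v.2.2)).
Proof.
move=> Rf; pose h (i : 'I_k.+1) : 'I_k.+2 :=
  if unlift ord0 i is Some j then lift ord0 (lift ord0 j) else ord0.
apply: rec_ext (rec_comp Rf (fun i => rec_proj (h i))) => v.
case/tupleP: v => x v; case/tupleP: v => y v; congr (f _).
rewrite /= enum_ordSl /= /h unlift_none -map_comp; congr (_, env_of _ _).
rewrite -[RHS]map_tnth_enum; apply: eq_map => i /=.
by rewrite liftK !tnthS.
Qed.

Lemma Rec_head k : Rec (fun v : env k.+1 => v.1).
Proof. by apply: rec_ext (rec_proj ord0) => v; case/tupleP: v. Qed.

Lemma Rec_cons k (f : env k.+1 -> nat) (a : env k -> nat) :
  Rec f -> Rec a -> Rec (fun v => f (a v, v)).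
Proof.
move=> Rf Ra; pose g (i : 'I_k.+1) (v : k.-tuple nat) :=
  if unlift ord0 i is Some j then tnth v j else a (env_of k v).
have Rg i : recursive (g i).
  by rewrite /g; case: unlift => [j|]; [apply: rec_proj | apply: Ra].
apply: rec_ext (rec_comp Rf Rg) => v; congr (f _).
rewrite /= enum_ordSl /= /g unlift_none -map_comp; congr (_, env_of _ _).
rewrite -[RHS]map_tnth_enum; apply: eq_map => i /=.
by rewrite liftK.
Qed.

Lemma Rec_comp1 k (f : nat -> nat) (a : env k -> nat) :
  Rec (fun v : env 1 => f v.1) -> Rec a -> Rec (fun v => f (a v)).
Proof.
move=> Rf Ra; apply: Rec_ext (Rec_comp Rf (fun i : 'I_1 => Ra)) => v /=.
by rewrite enum_ordSl.
Qed.

Lemma Rec_comp2 k (f : nat -> nat -> nat) (a b : env k -> nat) :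
  Rec (fun v : env 2 => f v.1 v.2.1) -> Rec a -> Rec b ->
  Rec (fun v => f (a v) (b v)).
Proof.
move=> Rf Ra Rb; pose g (i : 'I_2) := nth a [:: a; b] i.
have Rg i : Rec (g i) by case: i => [[|[]]].
apply: Rec_ext (Rec_comp Rf Rg) => v /=.
by rewrite !enum_ordSl.
Qed.

Lemma Rec_comp3 k (f : nat -> nat -> nat -> nat) (a b c : env k -> nat) :
  Rec (fun v : env 3 => f v.1 v.2.1 v.2.2.1) -> Rec a -> Rec b -> Rec c ->
  Rec (fun v => f (a v) (b v) (c v)).
Proof.
move=> Rf Ra Rb Rc; pose g (i : 'I_3) := nth a [:: a; b; c] i.
have Rg i : Rec (g i) by case: i => [[|[|[]]]].
apply: Rec_ext (Rec_comp Rf Rg) => v /=.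
by rewrite !enum_ordSl.
Qed.

Lemma Rec_comp4 k (f : nat -> nat -> nat -> nat -> nat) (a b c d : env k -> nat) :
  Rec (fun v : env 4 => f v.1 v.2.1 v.2.2.1 v.2.2.2.1) ->
  Rec a -> Rec b -> Rec c -> Rec d -> Rec (fun v => f (a v) (b v) (c v) (d v)).
Proof.
move=> Rf Ra Rb Rc Rd; pose g (i : 'I_4) := nth a [:: a; b; c; d] i.
have Rg i : Rec (g i) by case: i => [[|[|[|[]]]]].
apply: Rec_ext (Rec_comp Rf Rg) => v /=.
by rewrite !enum_ordSl.
Qed.

Lemma Rec_succ k (a : env k -> nat) : Rec a -> Rec (fun v => (a v).+1).
Proof.
by apply: Rec_comp1; apply: rec_ext rec_succ => v; case/tupleP: v.
Qed.

Lemma Rec_const k n : Rec (fun _ : env k => n).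
Proof.
elim: n => [|n IH]; last exact: Rec_succ.
have R0 (i : 'I_0) : recursive (fun _ : k.-tuple nat => 0) by case: i.
exact: rec_comp rec_zero R0.
Qed.

Lemma Rec_iteri k (n x : env k -> nat) (f : env k -> nat -> nat -> nat) :
  Rec n -> Rec x -> Rec (fun v : env k.+2 => f v.2.2 v.1 v.2.1) ->
  Rec (fun v => iteri (n v) (f v) (x v)).
Proof.
move=> Rn Rx Rf.
have R : Rec (fun v : env k.+1 => iteri v.1 (f v.2) (x v.2)).
  apply: rec_ext (rec_prec Rx Rf) => v; case/tupleP: v => m v /=.
  by rewrite theadE; elim: m => // m /= ->.
exact: Rec_cons R Rn.
Qed.

Lemma Rec_iter k (n x : env k -> nat) (f : env k -> nat -> nat) :
  Rec n -> Rec x -> Rec (fun v : env k.+1 => f v.2 v.1) ->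
  Rec (fun v => iter (n v) (f v) (x v)).
Proof.
move=> Rn Rx Rf.
have R : Rec (fun v => iteri (n v) (fun _ => f v) (x v)).
  by apply: Rec_iteri => //; apply: (Rec_tail Rf).
by apply: Rec_ext R => v; elim: (n v) => //= m ->.
Qed.

Ltac rec_var :=
  first [ exact: Rec_head
        | exact: (Rec_tail (@Rec_head _))
        | exact: (Rec_tail (Rec_tail (@Rec_head _)))
        | exact: (Rec_tail (Rec_tail (Rec_tail (@Rec_head _))))
        | exact: (Rec_tail (Rec_tail (Rec_tail (Rec_tail (@Rec_head _)))))
        | exact: (Rec_tail (Rec_tail (Rec_tail (Rec_tail (Rec_tail (@Rec_head _))))))
        | exact: (Rec_tail (Rec_tail (Rec_tail (Rec_tail (Rec_tail (Rec_tail
                   (@Rec_head _)))))))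
        | exact: (Rec_tail (Rec_tail (Rec_tail (Rec_tail (Rec_tail (Rec_tail
                   (Rec_tail (@Rec_head _)))))))) ].

Lemma Rec_pred k (a : env k -> nat) : Rec a -> Rec (fun v => (a v).-1).
Proof.
apply: (@Rec_comp1 _ predn).
have R : Rec (fun v : env 1 => iteri v.1 (fun i _ => i) 0).
  by apply: (Rec_iteri (f := fun _ i _ => i));
    [rec_var | exact: Rec_const | rec_var].
by apply: Rec_ext R => v; case: v.1.
Qed.

Lemma Rec_add k (a b : env k -> nat) : Rec a -> Rec b -> Rec (fun v => a v + b v).
Proof.
apply: Rec_comp2.
have R : Rec (fun v : env 2 => iter v.1 succn v.2.1).
  by apply: (Rec_iter (f := fun=> succn));
    [rec_var | rec_var | apply: Rec_succ; rec_var].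
by apply: Rec_ext R => v; rewrite iter_succn addnC.
Qed.

Lemma Rec_sub k (a b : env k -> nat) : Rec a -> Rec b -> Rec (fun v => a v - b v).
Proof.
apply: Rec_comp2.
have R : Rec (fun v : env 2 => iter v.2.1 predn v.1).
  by apply: (Rec_iter (f := fun=> predn));
    [rec_var | rec_var | apply: Rec_pred; rec_var].
by apply: Rec_ext R => v; rewrite iter_predn.
Qed.

Lemma Rec_mul k (a b : env k -> nat) : Rec a -> Rec b -> Rec (fun v => a v * b v).
Proof.
apply: Rec_comp2.
have R : Rec (fun v : env 2 => iter v.1 (addn v.2.1) 0).
  apply: (Rec_iter (f := fun v : env 2 => addn v.2.1) (x := fun=> 0));
    [rec_var | exact: Rec_const |].
  by apply: Rec_add; rec_var.
by apply: Rec_ext R => v; rewrite iter_addn_0 mulnC.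
Qed.

Lemma Rec_exp2 k (a : env k -> nat) : Rec a -> Rec (fun v => 2 ^ a v).
Proof.
move=> Ra; have R : Rec (fun v => iter (a v) (muln 2) 1).
  apply: (Rec_iter (f := fun=> muln 2) (x := fun=> 1)) => //;
    first exact: Rec_const.
  by apply: Rec_mul; [exact: Rec_const | rec_var].
apply: Rec_ext R => v; elim: (a v) => //= m ->.
by rewrite expnS.
Qed.

Lemma Rec_sum k (n : env k -> nat) (f : env k -> nat -> nat) :
  Rec n -> Rec (fun v : env k.+1 => f v.2 v.1) ->
  Rec (fun v => \sum_(i < n v) f v i).
Proof.
move=> Rn Rf.
have R : Rec (fun v => iteri (n v) (fun i r => r + f v i) 0).
  apply: (Rec_iteri (f := fun v i r => r + f v i) (x := fun=> 0)) => //;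
    first exact: Rec_const.
  by apply: Rec_add; [rec_var | exact: (Rec_skip Rf)].
apply: Rec_ext R => v; elim: (n v) => [|m IH]; first by rewrite big_ord0.
by rewrite big_ord_recr /= IH.
Qed.

Definition allb n (p : pred nat) := all p (iota 0 n).
Definition hasb n (p : pred nat) := has p (iota 0 n).

Lemma allbP n (p : pred nat) : reflect (forall i, i < n -> p i) (allb n p).
Proof.
apply: (iffP allP) => h i; first by move=> lt; apply: h; rewrite mem_iota.
by rewrite mem_iota; apply: h.
Qed.

Lemma hasbP n (p : pred nat) : reflect (exists2 i, i < n & p i) (hasb n p).
Proof.
by apply: (iffP hasP) => -[i]; rewrite ?mem_iota => lt pi; exists i;
  rewrite ?mem_iota.
Qed.

Lemma RecB_leq k (a b : env k -> nat) : Rec a -> Rec b -> RecB (fun v =>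
  a v <= b v).
Proof.
move=> Ra Rb.
have R : Rec (fun v => 1 - (a v - b v)).
  by apply: Rec_sub; [exact: Rec_const | exact: Rec_sub].
by apply: Rec_ext R => v; rewrite -subn_eq0; case: (a v - b v).
Qed.

Lemma RecB_and k (p q : env k -> bool) :
  RecB p -> RecB q -> RecB (fun v => p v && q v).
Proof.
by move=> Rp Rq; apply: Rec_ext (Rec_mul Rp Rq) => v; rewrite mulnb.
Qed.

Lemma RecB_not k (p : env k -> bool) : RecB p -> RecB (fun v => ~~ p v).
Proof.
by move=> Rp; apply: Rec_ext (Rec_sub (Rec_const k 1) Rp) => v; case: (p v).
Qed.

Lemma RecB_ext k (p q : env k -> bool) : p =1 q -> RecB p -> RecB q.
Proof. by move=> pq; apply: Rec_ext => v; rewrite pq. Qed.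

Lemma RecB_or k (p q : env k -> bool) :
  RecB p -> RecB q -> RecB (fun v => p v || q v).
Proof.
move=> Rp Rq; apply: RecB_ext (RecB_not (RecB_and (RecB_not Rp) (RecB_not Rq))).
by move=> v; rewrite -negb_or negbK.
Qed.

Lemma RecB_imp k (p q : env k -> bool) :
  RecB p -> RecB q -> RecB (fun v => p v ==> q v).
Proof.
by move=> Rp Rq; apply: RecB_ext (RecB_or (RecB_not Rp) Rq) => v; rewrite implybE.
Qed.

Lemma RecB_eq k (a b : env k -> nat) : Rec a -> Rec b -> RecB (fun v =>
  a v == b v).
Proof.
move=> Ra Rb; apply: RecB_ext (RecB_and (RecB_leq Ra Rb) (RecB_leq Rb Ra)) => v.
by rewrite eqn_leq.
Qed.

Lemma RecB_has k (n : env k -> nat) (p : env k -> nat -> bool) :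
  Rec n -> RecB (fun v : env k.+1 => p v.2 v.1) ->
  RecB (fun v => hasb (n v) (p v)).
Proof.
move=> Rn Rp.
have R : RecB (fun v => 1 <= \sum_(i < n v) p v i).
  by apply: RecB_leq; [exact: Rec_const | exact: (Rec_sum (f := fun v i =>
    nat_of_bool (p v i)) Rn Rp)].
apply: RecB_ext R => v; rewrite lt0n sum_nat_eq0 negb_forall.
apply/existsP/hasbP => [[i]|[i lt pi]]; first by case pi: (p v i) => // _;
  exists i.
by exists (Ordinal lt); rewrite /= pi.
Qed.

Lemma RecB_all k (n : env k -> nat) (p : env k -> nat -> bool) :
  Rec n -> RecB (fun v : env k.+1 => p v.2 v.1) ->
  RecB (fun v => allb (n v) (p v)).
Proof.
move=> Rn Rp.
apply: RecB_ext (RecB_not (RecB_has (p := fun v i => ~~ p v i) Rn (RecB_not Rp))).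
by move=> v; rewrite -all_predC; apply: eq_all => i /=; rewrite negbK.
Qed.

Lemma RecB_comp1 k (f : nat -> bool) (a : env k -> nat) :
  RecB (fun v : env 1 => f v.1) -> Rec a -> RecB (fun v => f (a v)).
Proof. exact: (@Rec_comp1 _ (fun x => nat_of_bool (f x))). Qed.

Lemma RecB_comp2 k (f : nat -> nat -> bool) (a b : env k -> nat) :
  RecB (fun v : env 2 => f v.1 v.2.1) -> Rec a -> Rec b ->
  RecB (fun v => f (a v) (b v)).
Proof. exact: (@Rec_comp2 _ (fun x y => nat_of_bool (f x y))). Qed.

Lemma RecB_comp3 k (f : nat -> nat -> nat -> bool) (a b c : env k -> nat) :
  RecB (fun v : env 3 => f v.1 v.2.1 v.2.2.1) -> Rec a -> Rec b -> Rec c ->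
  RecB (fun v => f (a v) (b v) (c v)).
Proof. exact: (@Rec_comp3 _ (fun x y z => nat_of_bool (f x y z))). Qed.

Lemma RecB_comp4 k (f : nat -> nat -> nat -> nat -> bool) (a b c d : env k ->
  nat) :
  RecB (fun v : env 4 => f v.1 v.2.1 v.2.2.1 v.2.2.2.1) ->
  Rec a -> Rec b -> Rec c -> Rec d -> RecB (fun v => f (a v) (b v) (c v) (d v)).
Proof. exact: (@Rec_comp4 _ (fun x y z t => nat_of_bool (f x y z t))). Qed.

Lemma Rec_bool k (p : env k -> bool) : RecB p -> Rec (fun v => nat_of_bool (p v)).
Proof. by []. Qed.

Lemma RecB_odd k (a : env k -> nat) : Rec a -> RecB (fun v => odd (a v)).
Proof.
apply: RecB_comp1.
(* The map [r |-> 1 - r] exchanges the truth values [0] and [1]. *)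
have R : Rec (fun v : env 1 => iter v.1 (subn 1) 0).
  apply: (Rec_iter (f := fun=> subn 1) (x := fun=> 0));
    [rec_var | exact: Rec_const |].
  by apply: Rec_sub; [exact: Rec_const | rec_var].
apply: Rec_ext R => v; elim: v.1 => //= m ->.
by case: odd.
Qed.

Lemma Rec_half k (a : env k -> nat) : Rec a -> Rec (fun v => (a v)./2).
Proof.
apply: (@Rec_comp1 _ half).
(* There are [n./2] odd numbers below [n]. *)
have R : Rec (fun v : env 1 => \sum_(i < v.1) odd i).
  by apply: (Rec_sum (f := fun=> odd)); [rec_var | apply: RecB_odd; rec_var].
apply: Rec_ext R => v; elim: v.1 => [|m IH]; first by rewrite big_ord0.
by rewrite big_ord_recr /= IH uphalf_half addnC.
Qed.

(** A head symbol that the goal matching of [rec_base] can see; [allb] and [hasb] play this part for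
    bounded quantifiers. *)
Definition sumb n (f : nat -> nat) := \sum_(i < n) f i.

Lemma Rec_sumb k (n : env k -> nat) (f : env k -> nat -> nat) :
  Rec n -> Rec (fun v : env k.+1 => f v.2 v.1) -> Rec (fun v => sumb (n v) (f v)).
Proof. exact: Rec_sum. Qed.

(** * Binary digits and codes of sequences *)

Definition testbit c i := odd (iter i half c).
(* The code of [n :: s] is [2 ^ n * (2 * code s + 1)]: the head is the 2-adic
   valuation, and [0] codes the empty sequence. *)
Definition code_head c := sumb c (fun i => allb i.+1 (fun j => ~~ testbit c j)).
Definition code_tail c := iter (code_head c).+1 half c.
Definition code_nth c i := code_head (iter i code_tail c).
(** Counts the non-empty tails; the bound [c] is large enough because a code is at least the length
    of its sequence. *)
Definition code_size c := sumb c (fun i => iter i code_tail c != 0).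
Definition mask n (p : pred nat) := sumb n (fun i => p i * 2 ^ i).

Ltac rec_base := cbv beta; lazymatch goal with
  | |- Rec (fun v => nat_of_bool _) => apply: Rec_bool
  | |- Rec (fun v => _.+1) => apply: Rec_succ
  | |- Rec (fun v => _ + _) => apply: Rec_add
  | |- Rec (fun v => _ * _) => apply: Rec_mul
  | |- Rec (fun v => 2 ^ _) => apply: Rec_exp2
  | |- Rec (fun v => half _) => apply: Rec_half
  | |- Rec (fun v => sumb _ _) => apply: Rec_sumb
  | |- Rec (fun v => iter _ _ _) => apply: Rec_iter
  | |- RecB (fun v => odd _) => apply: RecB_odd
  | |- RecB (fun v => _ <= _) => apply: RecB_leq
  | |- RecB (fun v => _ == _) => apply: RecB_eq
  | |- RecB (fun v => _ && _) => apply: RecB_and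
  | |- RecB (fun v => _ || _) => apply: RecB_or
  | |- RecB (fun v => ~~ _) => apply: RecB_not
  | |- RecB (fun v => _ ==> _) => apply: RecB_imp
  | |- RecB (fun v => hasb _ _) => apply: RecB_has
  | |- RecB (fun v => allb _ _) => apply: RecB_all
  | |- Rec _ => first [rec_var | exact: Rec_const]
  end.

Lemma RecB_testbit k (a b : env k -> nat) : Rec a -> Rec b -> RecB (fun v =>
  testbit (a v) (b v)).
Proof. apply: RecB_comp2; rewrite /testbit; do ?rec_base. Qed.

Lemma Rec_code_head k (a : env k -> nat) : Rec a -> Rec (fun v =>
  code_head (a v)).
Proof.
apply: Rec_comp1; rewrite /code_head; do ?[rec_base | apply: RecB_testbit].
Qed.

Lemma Rec_code_tail k (a : env k -> nat) : Rec a -> Rec (fun v =>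
  code_tail (a v)).
Proof. by apply: Rec_comp1; rewrite /code_tail;
  do ?[rec_base | apply: Rec_code_head]. Qed.

Lemma Rec_code_nth k (a b : env k -> nat) :
  Rec a -> Rec b -> Rec (fun v => code_nth (a v) (b v)).
Proof.
by apply: Rec_comp2; rewrite /code_nth;
  do ?[apply: Rec_code_head | apply: Rec_code_tail | rec_base].
Qed.

Lemma Rec_code_size k (a : env k -> nat) : Rec a -> Rec (fun v =>
  code_size (a v)).
Proof. by apply: Rec_comp1; rewrite /code_size;
  do ?[apply: Rec_code_tail | rec_base]. Qed.

Lemma Rec_mask k (n : env k -> nat) (p : env k -> nat -> bool) :
  Rec n -> RecB (fun v : env k.+1 => p v.2 v.1) ->
  Rec (fun v => mask (n v) (p v)).
Proof.
by move=> Rn Rp; rewrite /mask; apply: Rec_sumb => //; do ?rec_base.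
Qed.

(** * The decision procedures *)

Lemma sumb_lt c n : sumb c (fun i => i < n) = minn c n.
Proof.
rewrite /sumb; elim: c => [|c IH]; first by rewrite big_ord0 min0n.
by rewrite big_ord_recr /= IH; case: ltnP => h /=; lia.
Qed.

Lemma eq_sumb n f g : (forall i, i < n -> f i = g i) -> sumb n f = sumb n g.
Proof. by move=> fg; apply: eq_bigr => i _; apply: fg. Qed.

Lemma iter_half_exp2 n x : iter n half (2 ^ n * x) = x.
Proof.
elim: n x => [|n IH] x; first by rewrite mul1n.
by rewrite iterSr expnS -mulnA mul2n doubleK IH.
Qed.

Lemma testbit_exp2 n x j : j <= n -> testbit (2 ^ n * x.*2.+1) j = (j == n).
Proof.
rewrite /testbit => jn; rewrite -{1}(subnKC jn) expnD -mulnA iter_half_exp2.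
rewrite oddM oddX /= odd_double /= andbT orbF subn_eq0.
by rewrite eqn_leq jn.
Qed.

Lemma code_cons n s :
  CodeSeq.code (n :: s) = 2 ^ n * (CodeSeq.code s).*2.+1.
Proof. by []. Qed.

Lemma code_head_code n s : code_head (CodeSeq.code (n :: s)) = n.
Proof.
rewrite code_cons; set c := _ * _.
(* The sum defining [code_head] stops at [c], so it reaches the valuation [n] only if [n <= c]. *)
have nc : n <= c.
  by rewrite (leq_trans (ltnW (ltn_expl n (ltnSn 1)))) // leq_pmulr.
rewrite /code_head (eq_sumb (g := fun i => i < n)) ?sumb_lt;
  first by apply/minn_idPr.
move=> i _; congr nat_of_bool; apply/allbP/idP => [h|lt j].
  rewrite ltnNge; apply/negP => le; have := h n le.
  by rewrite testbit_exp2 ?eqxx.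
rewrite ltnS => le; rewrite testbit_exp2; last by lia.
by lia.
Qed.

Lemma code_tail_code n s : code_tail (CodeSeq.code (n :: s)) = CodeSeq.code s.
Proof.
rewrite /code_tail code_head_code code_cons iterS iter_half_exp2.
by rewrite -add1n halfD odd_double /= doubleK.
Qed.

Lemma iter_code_tail_code i s :
  iter i code_tail (CodeSeq.code s) = CodeSeq.code (drop i s).
Proof.
elim: i s => [|i IH] s; first by rewrite drop0.
rewrite iterSr; case: s => [|n s]; last by rewrite code_tail_code IH.
have -> : code_tail (CodeSeq.code [::]) = CodeSeq.code [::].
  by rewrite /code_tail; elim: (_.+1) => // m /= ->.
by rewrite IH.
Qed.

Lemma code_nth_code s i : code_nth (CodeSeq.code s) i = nth 0 s i.
Proof.
rewrite /code_nth iter_code_tail_code -[i in RHS]addn0 -nth_drop.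
by case: (drop i s) => [|n t];
  rewrite ?code_head_code // /code_head /sumb big_ord0.
Qed.

Lemma size_leq_code s : size s <= CodeSeq.code s.
Proof.
elim: s => // n s IH; rewrite code_cons /=.
have : 0 < 2 ^ n by rewrite expn_gt0.
by move: (2 ^ n) (CodeSeq.code s) IH => p c; nia.
Qed.

Lemma code_size_code s : code_size (CodeSeq.code s) = size s.
Proof.
rewrite /code_size (eq_sumb (g := fun i => i < size s)).
  by rewrite sumb_lt; apply/minn_idPr; apply: size_leq_code.
move=> i _; rewrite iter_code_tail_code -subn_gt0 -size_drop.
by case: (drop i s) => // n t; rewrite code_cons muln_eq0 expn_eq0.
Qed.

Lemma mask_recl n p : mask n.+1 p = p 0 + (mask n (fun i => p i.+1)).*2.
Proof.
rewrite /mask /sumb big_ord_recl muln1 -muln2 big_distrl; congr (_ + _).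
by apply: eq_bigr => i _; rewrite lift0 expnSr mulnA.
Qed.

Lemma testbit_mask n p i : i < n -> testbit (mask n p) i = p i.
Proof.
elim: n p i => // n IH p [_|i lti]; rewrite mask_recl /testbit.
  by rewrite /= oddD odd_double addbF; case: (p 0).
rewrite iterSr halfD odd_double andbF add0n doubleK.
have -> : (p 0 : nat)./2 = 0 by case: (p 0).
exact: IH.
Qed.

Lemma mask_lt n p : mask n p < 2 ^ n.
Proof.
elim: n p => [|n IH] p; first by rewrite /mask /sumb big_ord0.
by rewrite mask_recl expnS; have := IH (fun i => p i.+1); case: (p 0); lia.
Qed.

(* Number-theoretic transcription of derivability.  A finite monoid is given by
   the code [T] of its table, a subset by the number whose binary digits are its
   characteristic function, and a set of pairs of subsets by a number in the
   same way, the pair [(y, w)] having the index [y + 2 ^ n * w]. *)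
Definition mulT T i j := code_nth (code_nth T i) j.

Definition subset_code T y z := allb (code_size T) (fun i => testbit y i ==>
  testbit z i).

Definition subset_mul_code T y x z :=
  allb (code_size T) (fun i => testbit y i ==>
    hasb (code_size T) (fun j => hasb (code_size T) (fun k =>
      [&& testbit x j, testbit z k & mulT T j k == i]))).

Definition mul_subset_code T x z y :=
  allb (code_size T) (fun j => allb (code_size T) (fun k =>
    testbit x j && testbit z k ==> testbit y (mulT T j k))).

(** The table does not mark the unit, which is recognized as the only left identity. *)
Definition unit_code T i := allb (code_size T) (fun j => mulT T i j == j).

Definition spanned_code T z q :=
  allb (2 ^ code_size T) (fun r =>
    allb (code_size T) (fun i => unit_code T i ==> testbit r i) &&
      mul_subset_code T r z r
    ==> subset_code T q r).

Definition pair_code T F y w := testbit F (y + 2 ^ code_size T * w).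

Definition closed_point T F :=
  allb (code_size T) (fun m => allb (2 ^ code_size T) (fun y =>
    allb (2 ^ code_size T) (fun w =>
    allb (code_size T) (fun i => ~~ testbit w i && (testbit y i ==> (i == m)))
    ==> pair_code T F y w))).

(** The conclusion ranges over all subsets of the product, so that no code of the product set has to
    be computed; [derivable_sub] makes this harmless. *)
Definition closed_mul T F :=
  allb (2 ^ code_size T) (fun x => allb (2 ^ code_size T) (fun v =>
  allb (2 ^ code_size T) (fun z => allb (2 ^ code_size T) (fun w =>
  allb (2 ^ code_size T) (fun y =>
    [&& pair_code T F x v, pair_code T F z w & subset_mul_code T y x z] ==>
      pair_code T F y w))))).

Definition closed_pow T F :=
  allb (2 ^ code_size T) (fun z => allb (2 ^ code_size T) (fun w =>
  allb (2 ^ code_size T) (fun q => allb (2 ^ code_size T) (fun u =>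
    [&& pair_code T F z w, subset_mul_code T q q z, spanned_code T z q
      & allb (code_size T) (fun i => testbit u i ==> testbit w i || testbit z i)]
    ==> pair_code T F q u)))).

Definition closed_span T F :=
  allb (2 ^ code_size T) (fun z => allb (2 ^ code_size T) (fun w =>
  allb (2 ^ code_size T) (fun u =>
    pair_code T F z w && spanned_code T w u ==> pair_code T F z u))).

Definition closed_sub T F :=
  allb (2 ^ code_size T) (fun z => allb (2 ^ code_size T) (fun w =>
  allb (2 ^ code_size T) (fun y => allb (2 ^ code_size T) (fun u =>
    [&& pair_code T F z w, subset_code T y z & subset_code T u w] ==>
      pair_code T F y u)))).

Definition closed_code T F :=
  [&& closed_point T F, closed_mul T F, closed_pow T F, closed_span T F
    & closed_sub T F].

(** The derivable pairs are the intersection of all closed sets of pairs, and these sets have codes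
    below a computable bound; no fixpoint iteration has to be coded. *)
Definition derivable_code T y w :=
  allb (2 ^ (2 ^ code_size T * 2 ^ code_size T)) (fun F =>
    closed_code T F ==> pair_code T F y w).

Definition mem_code s i := hasb (code_size s) (fun j => code_nth s j == i).

Definition set_mask T s := mask (code_size T) (mem_code s).

Definition decide_pair c :=
  derivable_code (code_nth c 0) (set_mask (code_nth c 0) (code_nth c 1))
    (set_mask (code_nth c 0) (code_nth c 2)).

Definition edge_mask T es :=
  mask (code_size T) (fun i => hasb (code_size es) (fun e =>
    mem_code (code_nth (code_nth es e) 2) i)).

Definition decide_labelling c :=
  derivable_code (code_nth c 0) (set_mask (code_nth c 0)
    (code_nth (code_nth c 1) 0))
    (edge_mask (code_nth c 0) (code_nth c 2)).

Lemma Rec_mulT k (a b c : env k -> nat) : Rec a -> Rec b -> Rec c ->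
  Rec (fun v => mulT (a v) (b v) (c v)).
Proof. by apply: Rec_comp3; rewrite /mulT;
  do ?[apply: Rec_code_nth | rec_base]. Qed.

Ltac rec_code := cbv beta; lazymatch goal with
  | |- Rec (fun v => code_nth _ _) => apply: Rec_code_nth
  | |- Rec (fun v => code_size _) => apply: Rec_code_size
  | |- Rec (fun v => mulT _ _ _) => apply: Rec_mulT
  | |- Rec (fun v => mask _ _) => apply: Rec_mask
  | |- RecB (fun v => testbit _ _) => apply: RecB_testbit
  | |- _ => rec_base
  end.

Lemma RecB_subset_code k (a b c : env k -> nat) : Rec a -> Rec b -> Rec c ->
  RecB (fun v => subset_code (a v) (b v) (c v)).
Proof. by apply: RecB_comp3; rewrite /subset_code; do ?rec_code. Qed.

Lemma RecB_subset_mul_code k (a b c d : env k -> nat) : Rec a -> Rec b ->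
  Rec c -> Rec d ->
  RecB (fun v => subset_mul_code (a v) (b v) (c v) (d v)).
Proof. by apply: RecB_comp4; rewrite /subset_mul_code; do ?rec_code. Qed.

Lemma RecB_mul_subset_code k (a b c d : env k -> nat) : Rec a -> Rec b ->
  Rec c -> Rec d ->
  RecB (fun v => mul_subset_code (a v) (b v) (c v) (d v)).
Proof. by apply: RecB_comp4; rewrite /mul_subset_code; do ?rec_code. Qed.

Lemma RecB_unit_code k (a b : env k -> nat) : Rec a -> Rec b ->
  RecB (fun v => unit_code (a v) (b v)).
Proof. by apply: RecB_comp2; rewrite /unit_code; do ?rec_code. Qed.

Lemma RecB_spanned_code k (a b c : env k -> nat) : Rec a -> Rec b -> Rec c ->
  RecB (fun v => spanned_code (a v) (b v) (c v)).
Proof.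
by apply: RecB_comp3; rewrite /spanned_code;
  do ?[apply: RecB_unit_code | apply: RecB_mul_subset_code | apply: RecB_subset_code | rec_code].
Qed.

Lemma RecB_pair_code k (a b c d : env k -> nat) : Rec a -> Rec b -> Rec c ->
  Rec d ->
  RecB (fun v => pair_code (a v) (b v) (c v) (d v)).
Proof. by apply: RecB_comp4; rewrite /pair_code; do ?rec_code. Qed.

Ltac rec_closed := cbv beta; lazymatch goal with
  | |- RecB (fun v => subset_code _ _ _) => apply: RecB_subset_code
  | |- RecB (fun v => subset_mul_code _ _ _ _) => apply: RecB_subset_mul_code
  | |- RecB (fun v => spanned_code _ _ _) => apply: RecB_spanned_code
  | |- RecB (fun v => pair_code _ _ _ _) => apply: RecB_pair_code
  | |- _ => rec_code
  end.

Lemma RecB_closed_code k (a b : env k -> nat) : Rec a -> Rec b ->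
  RecB (fun v => closed_code (a v) (b v)).
Proof.
apply: RecB_comp2.
rewrite /closed_code /closed_point /closed_mul /closed_pow /closed_span /closed_sub.
by do ?rec_closed.
Qed.

Lemma RecB_derivable_code k (a b c : env k -> nat) : Rec a -> Rec b -> Rec c ->
  RecB (fun v => derivable_code (a v) (b v) (c v)).
Proof.
by apply: RecB_comp3; rewrite /derivable_code;
  do ?[apply: RecB_closed_code | rec_closed].
Qed.

Lemma RecB_mem_code k (a b : env k -> nat) : Rec a -> Rec b ->
  RecB (fun v => mem_code (a v) (b v)).
Proof. by apply: RecB_comp2; rewrite /mem_code; do ?rec_code. Qed.

Lemma recursive_predI d : RecB (fun v : env 1 => d v.1) -> recursive_pred d.
Proof. by apply: rec_ext => v; case/tupleP: v. Qed.

Lemma recursive_decide_pair : recursive_pred decide_pair.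
Proof.
apply: recursive_predI; rewrite /decide_pair /set_mask.
by apply: RecB_derivable_code; do ?[apply: RecB_mem_code | rec_code].
Qed.

Lemma recursive_decide_labelling : recursive_pred decide_labelling.
Proof.
apply: recursive_predI; rewrite /decide_labelling /set_mask /edge_mask.
by apply: RecB_derivable_code; do ?[apply: RecB_mem_code | rec_code].
Qed.

Lemma nth_enum_index (I : finType) (S : Type) (s0 : S) (f : I -> S) x :
  nth s0 [seq f y | y <- enum I] (index_of x) = f x.
Proof.
by rewrite /index_of (nth_map x) ?nth_enum_rank // -cardE ltn_ord.
Qed.

Lemma index_of_surj (I : finType) i : i < #|I| -> exists x : I, index_of x = i.
Proof.
by move=> lti; exists (enum_val (Ordinal lti)); rewrite /index_of enum_valK.
Qed.

(** * Correctness of the transcription *)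

Section Decoding.
Variable M : finMonoidType.
Local Notation T := (code_table M).
Local Notation n := #|M|.
Local Notation rank := (@index_of M).

Definition setof c : {set M} := [set x | testbit c (rank x)].

Lemma code_size_table : code_size T = n.
Proof. by rewrite code_size_code size_map -cardE. Qed.

Lemma mulT_table x y : mulT T (rank x) (rank y) = rank (x * y)%g.
Proof. by rewrite /mulT code_nth_code nth_enum_index code_nth_code nth_enum_index. Qed.

Lemma index_inj : injective rank.
Proof. by move=> x y /val_inj /enum_rank_inj. Qed.

Lemma allb_index (p : pred nat) : reflect (forall x,
  p (rank x)) (allb (code_size T) p).
Proof.
rewrite code_size_table; apply: (iffP (allbP _ _)) => h i;
  first exact: h (ltn_ord _).
by move=> /index_of_surj[x <-].
Qed.

Lemma hasb_index (p : pred nat) : reflect (exists x,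
  p (rank x)) (hasb (code_size T) p).
Proof.
rewrite code_size_table; apply: (iffP (hasbP _ _)) =>
  [[_ /index_of_surj[x <-] px]|[x px]].
  by exists x.
by exists (rank x) => //; apply: ltn_ord.
Qed.

Lemma setof_mask (p : pred nat) : setof (mask n p) = [set x | p (rank x)].
Proof. by apply/setP=> x; rewrite !inE testbit_mask // ltn_ord. Qed.

Lemma setof_surj X : exists2 c, c < 2 ^ n & setof c = X.
Proof.
exists (mask n (fun i => i \in [seq rank x | x <- enum X])); first exact: mask_lt.
by rewrite setof_mask; apply/setP=> x; rewrite inE (mem_map index_inj) mem_enum.
Qed.

Lemma allb_setof (p : pred nat) : allb (2 ^ code_size T) p <-> forall c,
  c < 2 ^ n -> p c.
Proof. by rewrite code_size_table; split=> /allbP. Qed.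

Lemma subset_codeE y z : subset_code T y z = (setof y \subset setof z).
Proof.
apply/allb_index/subsetP => h x; have := h x; rewrite !inE => /implyP //.
Qed.

Lemma subset_mul_codeE y x z :
  subset_mul_code T y x z = (setof y \subset (setof x * setof z)%g).
Proof.
apply/allb_index/subsetP => h m.
  rewrite inE => ym; have /implyP/(_ ym)/hasb_index[a /hasb_index[b]] := h m.
  rewrite mulT_table => /and3P[xa zb /eqP/index_inj <-].
  by apply: mem_mulS; rewrite inE.
apply/implyP=> ym.
have /h/mulSP[a [b []]] : m \in setof y by rewrite inE.
rewrite !inE => xa zb ->; apply/hasb_index; exists a; apply/hasb_index; exists b.
by rewrite xa zb mulT_table /=.
Qed.

Lemma mul_subset_codeE x z y :
  mul_subset_code T x z y = ((setof x * setof z)%g \subset setof y).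
Proof.
apply/allb_index/subsetP => h.
  move=> m /mulSP[a [b [+ + ->]]]; rewrite !inE => xa zb.
  by have /allb_index/(_ b)/implyP := h a; rewrite mulT_table xa zb; apply.
move=> a; apply/allb_index=> b; apply/implyP=> /andP[xa zb].
by have := h (a * b)%g; rewrite inE mulT_table; apply; apply: mem_mulS;
  rewrite inE.
Qed.

Lemma unit_codeE x : unit_code T (rank x) = (x == 1%g).
Proof.
apply/allb_index/eqP => [/(_ 1%g)|-> y]; rewrite mulT_table.
  by rewrite mulg1 => /eqP/index_inj.
by rewrite mul1g.
Qed.

Lemma spanned_codeP z q : spanned_code T z q <-> spanned (setof z) (setof q).
Proof.
have oneP r : allb (code_size T) (fun i => unit_code T i ==>
  testbit r i) = (1%g \in setof r).
  apply/allb_index/idP => [/(_ 1%g)|r1 x]; rewrite unit_codeE.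
    by rewrite eqxx inE.
  by apply/implyP=> /eqP->; rewrite inE in r1.
split=> [/allb_setof h R|h].
  have [r ltr <-] := setof_surj R => R1 RZ; have := h r ltr.
  by rewrite oneP mul_subset_codeE subset_codeE R1 RZ.
apply/allb_setof=> r ltr; rewrite oneP mul_subset_codeE subset_codeE.
by apply/implyP=> /andP[]; apply: h.
Qed.

Lemma closed_code_derivable F :
  (forall y w, y < 2 ^ n -> w < 2 ^ n ->
     pair_code T F y w <-> derivable (setof y) (setof w)) ->
  closed_code T F.
Proof.
move=> FP; apply/and5P; split.
- apply/allb_index=> m; apply/allb_setof=> y lty; apply/allb_setof=> w ltw.
  apply/implyP=> /allb_index h; apply/FP => //.
  apply: derivable_sub (derivable_point m) _ _; apply/subsetP=> x.
    rewrite !inE => yx.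
    by have /andP[_ /implyP/(_ yx)/eqP/index_inj->] := h x.
  by rewrite inE; have /andP[/negbTE->] := h x.
- apply/allb_setof=> x ltx; apply/allb_setof=> v ltv; apply/allb_setof=> z ltz.
  apply/allb_setof=> w ltw; apply/allb_setof=> y lty.
  apply/implyP=> /and3P[/FP xv /FP zw]; rewrite subset_mul_codeE => yxz.
  apply/FP => //; apply: derivable_sub yxz (subxx _).
  by apply: derivable_mul; [apply: xv | apply: zw].
- apply/allb_setof=> z ltz; apply/allb_setof=> w ltw.
  apply/allb_setof=> q ltq; apply/allb_setof=> u ltu.
  apply/implyP=> /and4P[/FP zw]; rewrite subset_mul_codeE =>
    qqz /spanned_codeP zq /allb_index h.
  apply/FP => //; apply: derivable_sub (derivable_pow (zw _ _) qqz zq)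
    (subxx _) _ => //.
  by apply/subsetP=> x; rewrite !inE; apply/implyP.
- apply/allb_setof=> z ltz; apply/allb_setof=> w ltw; apply/allb_setof=> u ltu.
  apply/implyP=> /andP[/FP zw /spanned_codeP wu]; apply/FP => //.
  by apply: derivable_span wu; apply: zw.
apply/allb_setof=> z ltz; apply/allb_setof=> w ltw.
apply/allb_setof=> y lty; apply/allb_setof=> u ltu.
apply/implyP=> /and3P[/FP zw]; rewrite !subset_codeE => yz uw; apply/FP => //.
by apply: derivable_sub yz uw; apply: zw.
Qed.

Lemma pair_code_closed F Y W : closed_code T F -> derivable Y W ->
  forall y w, y < 2 ^ n -> w < 2 ^ n -> setof y = Y -> setof w = W ->
    pair_code T F y w.
Proof.
move=> /and5P[Fpoint Fmul Fpow Fspan Fsub].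
elim=> {Y W} [m|X V Z W _ IHX _ IHZ|Z W Q _ IH QZ ZQ|Z W W' _ IH WW'|
              Z W Z' W' _ IH sZ sW] y w lty ltw ey ew.
- move: Fpoint => /allb_index/(_ m)/allb_setof/(_ y lty)/allb_setof/(_ w ltw).
  move=> /implyP; apply; apply/allb_index=> x.
  have := in_set0 x; rewrite -ew inE => -> /=; apply/implyP => yx.
  by have : x \in setof y; [rewrite inE | rewrite ey => /set1P->].
- have [x ltx ex] := setof_surj X; have [v ltv ev] := setof_surj V.
  have [z ltz ez] := setof_surj Z.
  move: Fmul => /allb_setof/(_ x ltx)/allb_setof/(_ v ltv)/allb_setof/(_ z ltz).
  move=> /allb_setof/(_ w ltw)/allb_setof/(_ y lty)/implyP; apply.
  by rewrite IHX // IHZ // subset_mul_codeE ex ez ey /=.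
- have [z ltz ez] := setof_surj Z; have [v ltv ev] := setof_surj W.
  move: Fpow => /allb_setof/(_ z ltz)/allb_setof/(_ v ltv)/allb_setof/(_ y lty).
  move=> /allb_setof/(_ w ltw)/implyP; apply.
  rewrite IH // subset_mul_codeE ez ey QZ /=; apply/andP; split.
    by apply/spanned_codeP; rewrite ez ey.
  apply/allb_index=> x; apply/implyP => wx.
  have : x \in W :|: Z by rewrite -ew inE.
  by rewrite -ev -ez !inE.
- have [v ltv ev] := setof_surj W.
  move: Fspan => /allb_setof/(_ y lty)/allb_setof/(_ v ltv)/allb_setof/(_ w ltw).
  by move=> /implyP; apply; rewrite IH //=; apply/spanned_codeP; rewrite ev ew.
have [z ltz ez] := setof_surj Z; have [v ltv ev] := setof_surj W.
move: Fsub => /allb_setof/(_ z ltz)/allb_setof/(_ v ltv)/allb_setof/(_ y lty).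
move=> /allb_setof/(_ w ltw)/implyP; apply.
by rewrite IH // !subset_codeE ez ev ey ew sZ.
Qed.

Lemma derivable_codeP y w : y < 2 ^ n -> w < 2 ^ n ->
  derivable_code T y w <-> derivable (setof y) (setof w).
Proof.
move=> lty ltw; split=> [/allbP h|yw]; last first.
  by apply/allbP=> F _; apply/implyP=> clF;
    apply: pair_code_closed yw _ _ _ _ _ _.
pose N := 2 ^ n; have N0 : 0 < N by rewrite expn_gt0.
(* The set of derivable pairs is itself one of the closed sets tested; the index of a pair is
   decoded by division by [N]. *)
pose F := mask (N * N) (fun i =>
  `[< derivable (setof (i %% N)) (setof (i %/ N)) >]).
have FE a b : a < N -> b < N ->
  pair_code T F a b <-> derivable (setof a) (setof b).
  move=> lta ltb; rewrite /pair_code code_size_table testbit_mask;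
    last by rewrite -/N; nia.
  rewrite -/N addnC mulnC divnMDl // modnMDl (divn_small lta) (modn_small lta)
    addn0.
  by split=> /asboolP.
have ltF : F < 2 ^ (2 ^ code_size T * 2 ^ code_size T)
  by rewrite code_size_table; apply: mask_lt.
have /implyP clF := h F ltF; apply/FE => //; apply: clF.
exact: closed_code_derivable FE.
Qed.

Lemma mem_code_code_set X i :
  mem_code (code_set X) i = (i \in [seq rank x | x <- enum X]).
Proof.
rewrite /mem_code code_size_code; apply/hasbP/(nthP 0) => -[j ltj].
  by rewrite code_nth_code => /eqP; exists j.
by move=> <-; exists j; rewrite // code_nth_code.
Qed.

Lemma setof_set_mask X : setof (set_mask T (code_set X)) = X.
Proof.
rewrite /set_mask code_size_table setof_mask; apply/setP=> x.
by rewrite inE mem_code_code_set (mem_map index_inj) mem_enum.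
Qed.

Lemma decide_pairP (Y U : {set M}) :
  decide_pair (code_pair Y U) <-> derivable Y U.
Proof.
rewrite /decide_pair /code_pair !code_nth_code /= derivable_codeP ?setof_set_mask //;
  by rewrite /set_mask code_size_table mask_lt.
Qed.

Lemma stable_pairE (Y U : {set M}) : monoid_closed (mem U) ->
  stable_pair aperiodic Y U <-> derivable Y U.
Proof.
move=> clU; rewrite -covered_derivable; split=> [[_ st] N phi apN relphi|st].
  exact: st.
by split=> // N phi apN relphi; apply: st.
Qed.

Section Labelling.
Variables (G : digraph) (l : labelling G M) (v0 : vertex G).
Hypothesis one_vertex : forall v, v = v0.
Hypothesis singletons : forall e, #|l (inr e)| = 1.

Let Y := l (inl v0).
Let W := \bigcup_e l (inr e).

(** At a single vertex labelled [k], commuting means that all edge labels stabilize [k]. As the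
    label of an edge is a singleton, one stabilizing element covers it, and covering the union [W]
    amounts to covering each edge. *)
Lemma inevitableE : inevitable aperiodic l <-> derivable Y W.
Proof.
rewrite -covered_derivable; split=> st N phi apN relphi.
  have [l' [comm rel]] := st N phi apN relphi.
  exists (l' (inl v0)); split; first exact: rel.
  apply/bigcupsP=> e _; apply: subset_trans (rel (inr e)) _.
  apply/subsetP=> m; rewrite inE => em; apply/mem_relpreim.
  exists (l' (inr e)); rewrite // inE; apply/eqP.
  by have := comm e; rewrite (one_vertex (init e)) (one_vertex (term e)).
have [k [Yk Wk]] := st N phi apN relphi.
have /choice[f fe] : forall e, exists t,
  t \in Stab k /\ l (inr e) \subset relinv phi t.
  move=> e; have /eqP/cards1P[m em] := singletons e.
  have /(subsetP Wk)/mem_relpreim[t kt tm] : m \in W.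
    by apply/bigcupP; exists e; rewrite ?em ?set11.
  by exists t; split=> //; rewrite em sub1set inE.
exists (fun x => match x with inl _ => k | inr e => f e end); split.
  by move=> e; have [+ _] := fe e; rewrite inE => /eqP.
by move=> [v|e]; [rewrite (one_vertex v) | have [] := fe e].
Qed.

Lemma decide_labellingP : decide_labelling (code_labelling l) <-> derivable Y W.
Proof.
have enumV : enum (vertex G) = [:: v0].
  have := enum_uniq (vertex G); have := mem_enum (vertex G) v0.
  case: (enum _) => [|a [|b s]] //; first by rewrite (one_vertex a).
  by move=> _; rewrite /= (one_vertex b) (one_vertex a) inE eqxx.
have eT : code_nth (code_labelling l) 0 =
  T by rewrite /code_labelling code_nth_code.
have eY : code_nth (code_nth (code_labelling l) 1) 0 = code_set Y.
  by rewrite /code_labelling code_nth_code code_nth_code [in LHS]enumV.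
rewrite /decide_labelling eT eY /code_labelling code_nth_code [nth _ _ _]/nth.
set es := CodeSeq.code [seq _ | e <- _].
have setW : setof (edge_mask T es) = W.
  rewrite /edge_mask code_size_table setof_mask; apply/setP=> x; rewrite inE.
  rewrite code_size_code size_map; apply/hasbP/bigcupP.
    rewrite -cardE => -[_ /index_of_surj[e <-]].
    rewrite code_nth_code nth_enum_index code_nth_code /= mem_code_code_set.
    by rewrite (mem_map index_inj) mem_enum => ex; exists e.
  move=> [e _ ex]; exists (index_of e); first by rewrite -cardE ltn_ord.
  rewrite code_nth_code nth_enum_index code_nth_code /= mem_code_code_set.
  by rewrite (mem_map index_inj) mem_enum.
rewrite derivable_codeP ?setof_set_mask ?setW // /set_mask /edge_mask code_size_table;
  exact: mask_lt.
Qed.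

End Labelling.

End Decoding.

Theorem corollary6p5 :
  stable_pairs_decidable aperiodic /\
  one_vertex_inevitability_decidable aperiodic.
Proof.
split.
  exists decide_pair; split; first exact: recursive_decide_pair.
  by move=> M Y U clU; rewrite decide_pairP stable_pairE.
exists decide_labelling; split; first exact: recursive_decide_labelling.
move=> M G l card_V singletons.
have [v0 one_vertex] : exists v0 : vertex G, forall v, v = v0.
  have /fintype1P[v0 ?] : #|vertex G| == 1 by apply/eqP. 
  by exists v0.
by rewrite (decide_labellingP l one_vertex) (inevitableE one_vertex).
Qed.
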